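(* Let $X^f(t)=B(S^f(t))$, $t\ge0$, where $B$ is a standard one-dimensional Brownian motion and $S^f$ is an inverse subordinator independent of $B$. (i) Both $X^f(t)$ and $Y^f(t):=\exp\{X^f(t)-\tfrac12 S^f(t)\}$, $t\ge 0$, are martingales with respect to the probability measure $\mathbb{P}$. (ii) Let $t\in[0,T]$. Then for each $\epsilon\ge 0$ the process $Z^f(t)=\exp\{X^f(t)\}$ is a martingale with respect to the probability measure $\mathbb{P}_\epsilon$ defined as \[ \mathbb{P}_\epsilon(A)=c_\epsilon\cdot\int_A \exp\Big\{-\tfrac12 X^f(T)-\big(\epsilon+\tfrac18\big)S^f(T)\Big\}\,d\mathbb{P}. \] Here $A\in\mathcal F$ and $c_\epsilon^{-1}=\int_\Omega \exp\{-\tfrac12 X^f(T)-(\epsilon+\tfrac18)S^f(T)\}\,d\mathbb{P}$ is the normalizing constant.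
   Context: Let $(\Omega,\mathcal F,\mathbb P)$ be a probability space. $T^f=(T^f(t))_{t\ge 0}$ is a subordinator, i.e. an increasing Lévy process (stationary and independent increments, right-continuous paths with finite left limits), with $\mathbb{E}(e^{-uT^f(t)})=e^{-tf(u)}$, where $f(u)=\int_{(0,\infty)}(1-e^{-ux})\,\nu(dx)$ (zero drift), and $\nu$ is a measure on $(0,\infty)$ with $\int_{(0,\infty)}\min\{1,x\}\,\nu(dx)<\infty$ and $\nu(0,\infty)=\infty$. The inverse subordinator is $S^f(t)=\inf\{\tau>0:T^f(\tau)>t\}$, $t\ge0$. The number $T$ in part (ii) is a fixed finite time horizon (not to be confused with the subordinator $T^f$). *)

(* Defs.v *)
From HB Require Import structures.
From mathcomp Require Import all_boot all_order all_algebra.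
From mathcomp Require Import all_classical all_reals all_analysis.

Set Implicit Arguments.
Unset Strict Implicit.
Unset Printing Implicit Defensive.

Import Order.TTheory GRing.Theory Num.Theory.
Import numFieldNormedType.Exports.

Local Open Scope classical_set_scope.
Local Open Scope ring_scope.

(* A real-valued stochastic process is a function [X : R -> T -> R], read as
   [X t w]; only its values at the times of the index set under consideration
   matter. *)

Section independence.
Context {d : measure_display} {T : measurableType d} {R : realType}.
Variable P : probability T R.

(* The product rule for subfamilies is the case where some [A i] are [setT]. *)
Definition mutually_independent (I : finType) (X : I -> T -> R) : Prop :=
  forall A : I -> set R, (forall i, measurable (A i)) ->
    P (\bigcap_i (X i @^-1` A i)) = (\prod_(i : I) P (X i @^-1` A i))%E.

Definition independent_sigma (G H : set (set T)) : Prop :=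
  forall A B, G A -> H B -> P (A `&` B) = (P A * P B)%E.

Definition sigma_process (I : set R) (X : R -> T -> R) : set (set T) :=
  <<s \bigcup_(t in I) preimage_set_system setT (X t) measurable >>.

Definition independent_processes (X Y : R -> T -> R) : Prop :=
  independent_sigma (sigma_process `[0, +oo[ X) (sigma_process `[0, +oo[ Y).

End independence.

Section martingales.
Context {d : measure_display} {T : measurableType d} {R : realType}.
Variable P : probability T R.

Definition is_filtration (I : set R) (F : R -> set (set T)) : Prop :=
  (forall t, I t -> sigma_algebra setT (F t) /\ F t `<=` measurable) /\
  (forall s t, I s -> I t -> s <= t -> F s `<=` F t).

Definition measurable_wrt (G : set (set T)) (Y : T -> R) : Prop :=
  forall A : set R, measurable A -> G (Y @^-1` A).

Definition is_cond_expectation (G : set (set T)) (X Y : T -> R) : Prop :=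
  [/\ measurable_wrt G Y,
      P.-integrable setT (EFin \o Y) &
      forall A, G A -> (\int[P]_(w in A) (Y w)%:E = \int[P]_(w in A) (X w)%:E)%E].

Definition is_martingale_wrt (I : set R) (F : R -> set (set T))
    (M : R -> T -> R) : Prop :=
  [/\ is_filtration I F,
      forall t, I t -> measurable_wrt (F t) (M t),
      forall t, I t -> P.-integrable setT (EFin \o M t) &
      forall s t, I s -> I t -> s <= t -> is_cond_expectation (F s) (M t) (M s)].

Definition natural_filtration (I : set R) (M : R -> T -> R) (t : R)
    : set (set T) :=
  sigma_process (I `&` [set s | s <= t]) M.

Definition is_martingale (I : set R) (M : R -> T -> R) : Prop :=
  is_martingale_wrt I (natural_filtration I M) M.

End martingales.

Section levy_processes.
Context {d : measure_display} {T : measurableType d} {R : realType}.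
Variable P : probability T R.

Definition is_process (X : R -> T -> R) : Prop :=
  forall t, 0 <= t -> measurable_fun setT (X t).

Definition independent_increments (X : R -> T -> R) : Prop :=
  forall (n : nat) (t : nat -> R), 0 <= t 0%N ->
    (forall i, (i < n)%N -> t i <= t i.+1) ->
    mutually_independent P (fun (i : 'I_n) w => X (t i.+1) w - X (t i) w).

Definition stationary_increments (X : R -> T -> R) : Prop :=
  forall s h : R, 0 <= s -> 0 <= h -> forall A : set R, measurable A ->
    P ((fun w => X (s + h) w - X s w) @^-1` A) =
    P ((fun w => X h w - X 0 w) @^-1` A).

Definition cadlag_paths (X : R -> T -> R) : Prop :=
  forall w, (forall t, 0 <= t -> X s w @[s --> t^'+] --> X t w) /\
            (forall t, 0 < t -> cvg (X s w @[s --> t^'-])).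

Definition is_levy_process (X : R -> T -> R) : Prop :=
  [/\ is_process X, {ae P, forall w, X 0 w = 0},
      independent_increments X, stationary_increments X & cadlag_paths X].

Definition is_subordinator (X : R -> T -> R) : Prop :=
  is_levy_process X /\
  (forall w s t, 0 <= s -> s <= t -> X s w <= X t w).

Definition is_brownian_motion (B : R -> T -> R) : Prop :=
  [/\ is_process B, {ae P, forall w, B 0 w = 0}, independent_increments B,
      (* the second parameter of [normal_prob] is the standard deviation *)
      (forall s t, 0 <= s -> s < t -> forall A : set R, measurable A ->
         P ((fun w => B t w - B s w) @^-1` A) =
         normal_prob 0 (Num.sqrt (t - s)) A) &
      (forall w, {within `[0, +oo[, continuous (fun t => B t w)})].

End levy_processes.

Section subordination.
Context {T : Type} {R : realType}.

(* Where the path [Tf ^~ w] is bounded by [t] the set is empty and [inf]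
   returns [0]; for a subordinator with infinite Levy measure this only
   happens on a null event. *)
Definition inverse_subordinator (Tf : R -> T -> R) (t : R) (w : T) : R :=
  inf [set tau : R | 0 < tau /\ t < Tf tau w].

Definition time_change (B S : R -> T -> R) (t : R) (w : T) : R := B (S t w) w.

End subordination.

Section levy_measures.
Context {R : realType}.

(* Only the restriction of [nu] to the Borel subsets of ]0, +oo[ is used: it
   stands for a measure on ]0, +oo[. *)
Variable nu : {measure set (measurableTypeR R) -> \bar R}.

Definition is_levy_measure : Prop :=
  (\int[nu]_(x in `]0%R, +oo[) (Num.min 1 x)%:E < +oo)%E.

Definition laplace_exponent (u : R) : R :=
  \int[nu]_(x in `]0, +oo[) (1 - expR (- (u * x))).

End levy_measures.

(* Main.v *)
Require Import Defs.
From HB Require Import structures.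
From mathcomp Require Import all_boot all_order all_algebra.
From mathcomp Require Import all_classical all_reals all_analysis.
From mathcomp Require Import measurable_realfun.
From mathcomp Require Import ring lra.
Set Implicit Arguments.
Unset Strict Implicit.
Unset Printing Implicit Defensive.
Import Order.TTheory GRing.Theory Num.Theory.
Import numFieldNormedType.Exports.
Local Open Scope classical_set_scope.
Local Open Scope ring_scope.

(* Condition on the clock [S], which is independent of [B]: by Fubini for the
   restrictions of [P] to sigma(B) and sigma(S), an expectation over the diagonal
   is an iterated integral in which [w] drives the Brownian motion and [v] the
   clock. An event of the natural filtration of [m (X_t, S_t)] at time [s] lifts
   to the product space, and its section at [v] belongs to the Brownian
   filtration at the frozen time [S s v] <= [S t v]. Each martingale identity
   thus reduces to the one for [B] at the deterministic times [S s v], [S t v]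
   and, for the tilted measure, [S T v].
   Integrability of [X] comes from E|B_t| <= C (1 + t) and E S_t < oo; the latter
   holds since the Laplace exponent is positive at [1] (the Levy measure is
   infinite) and S_t <= 1 + \sum_n exp (t - Tf n). *)

(** * Measures with a density *)

(** The diagonal formula is used in its Tonelli form, for nonnegative integrands. The exponential
    processes fit at once; [X] is signed, so its identity is first rewritten with the negative parts
    moved to the other side. The filtrations are the natural ones of [X], [Y] and [Z], each
    generated by some function [m] of the pair [(X, S)] and not by the pair itself; lifting events
    for an arbitrary measurable [m] treats the three cases together. Where a path of [Tf] stays
    below a level, the clock falls back to [inf set0 = 0] and is not monotone. This happens on a
    null event only, so the reduction to frozen times is made for almost every [v]. The constants of
    the tilted measure come from splitting [B t - B r / 2] (with [t <= r]) into weight [1/2] up to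
    [t] and weight [-1/2] on the increment from [t] to [r]. The two weights have the same square,
    hence both stretches grow at the rate [(1/2)^2 / 2 = 1/8] and the conditional mean does not
    depend on [t]. The term [1/8] of the density cancels this growth, and what remains,
    [exp (- eps * S_T)], is at most [1]. *)

Section density.
Context d (T : measurableType d) (R : realType).
Variables (mu nu : {measure set T -> \bar R}) (rho : T -> R).
Hypotheses (mrho : measurable_fun setT rho) (rho0 : forall x, 0 <= rho x).
Hypothesis nuE : forall A, measurable A ->
  nu A = (\int[mu]_(x in A) (rho x)%:E)%E.
Local Open Scope ereal_scope.
Import HBNNSimple.

Lemma ge0_integral_density (f : T -> \bar R) : measurable_fun setT f ->
  (forall x, 0 <= f x) -> \int[nu]_x f x = \int[mu]_x (f x * (rho x)%:E).
Proof.
move=> mf f0; pose f_ := nnsfun_approx measurableT mf.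
have fE x : (EFin \o f_ n) x @[n --> \oo] --> f x.
  by apply: cvg_nnsfun_approx.
transitivity (limn (fun n => \int[nu]_x (f_ n x)%:E)).
  rewrite -monotone_convergence//.
  - by apply: eq_integral => x _; apply/esym/cvg_lim => //; exact: fE.
  - by move=> n; exact/measurable_EFinP/measurable_funP.
  - by move=> n x _; rewrite lee_fin.
  - by move=> x _ m n mn; rewrite lee_fin; exact/lefP/nd_nnsfun_approx.
transitivity (limn (fun n => \int[mu]_x ((f_ n x)%:E * (rho x)%:E))); last first.
  rewrite -monotone_convergence//.
  - apply: eq_integral => x _; apply/cvg_lim => //.
    by apply: cvgeZr => //; exact: fE.
  - by move=> n; apply: emeasurable_funM; apply/measurable_EFinP.
  - by move=> n x _; rewrite -EFinM lee_fin mulr_ge0.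
  - move=> x _ m n mn; rewrite -!EFinM lee_fin ler_wpM2r//.
    exact/lefP/nd_nnsfun_approx.
congr (limn _); apply/funext => n.
under eq_integral do rewrite fimfunE -fsumEFin//.
rewrite ge0_integral_fsum//; last 2 first.
- by move=> y; exact/measurable_EFinP/measurable_funM.
- by move=> y x _; rewrite nnfun_muleindic_ge0.
have mA r : measurable (f_ n @^-1` [set r]) by [].
transitivity (\sum_(k \in range (f_ n))
    \int[mu]_x ((k * \1_(f_ n @^-1` [set k]) x)%:E * (rho x)%:E)).
  apply: eq_fsbigr => r _; rewrite integralZl_indic_nnsfun// integral_indic//.
  rewrite setIT nuE//.
  (* A negative [r] is not a value of the nonnegative [f_ n], so both sides vanish; for [r >= 0] the
     factor can leave a nonnegative integral. *)
  have [r0|r0] := ltP r 0%R.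
    rewrite preimage_nnfun0// integral_set0 mule0 integral0_eq// => x _.
    by rewrite indic0 mulr0 mul0e.
  under [RHS]eq_integral do rewrite EFinM -muleA.
  rewrite ge0_integralZl//; last 2 first.
  - by apply: emeasurable_funM; apply/measurable_EFinP.
  - by move=> x _; rewrite mule_ge0// lee_fin.
  congr (_ * _); rewrite [LHS]integral_mkcond; apply: eq_integral => x _.
  by rewrite epatch_indic/= muleC.
rewrite -ge0_integral_fsum//.
- apply: eq_integral => x _.
  rewrite [in RHS]fimfunE -fsumEFin// ge0_mule_fsuml//.
  by move=> r; rewrite nnfun_muleindic_ge0.
- move=> r; apply: emeasurable_funM; last exact/measurable_EFinP.
  exact/measurable_EFinP/measurable_funM.
- by move=> r x _; rewrite mule_ge0 ?nnfun_muleindic_ge0 ?lee_fin.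
Qed.

End density.

(** * Gaussian integrals *)

Section normal_moments.
Context {R : realType}.
Local Open Scope ereal_scope.

Lemma measurable_EFin_normal_pdf (m s : R) :
  measurable_fun setT (fun x : R => (normal_pdf m s x)%:E).
Proof. by apply/measurable_EFinP; exact: measurable_normal_pdf. Qed.

Lemma ge0_integral_normal_prob (m s : R) (f : R -> \bar R) :
  measurable_fun setT f -> (forall x, 0 <= f x) ->
  \int[normal_prob m s]_x f x =
  \int[lebesgue_measure]_x (f x * (normal_pdf m s x)%:E).
Proof.
move=> mf f0; apply: ge0_integral_density => //.
- exact: measurable_normal_pdf.
- exact: normal_pdf_ge0.
Qed.

(** Completing the square: [exp (a x)] times the density of mean [0] is a constant times the density
    of mean [a s^2], whose mass is [1]. *)
Lemma normal_mgf (s a : R) : s != 0%R ->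
  \int[normal_prob 0 s]_x (expR (a * x))%:E = (expR (a ^+ 2 * s ^+ 2 / 2))%:E.
Proof.
move=> s0; rewrite ge0_integral_normal_prob; last 2 first.
- by apply/measurable_EFinP/measurableT_comp.
- by move=> x; rewrite lee_fin expR_ge0.
transitivity (\int[lebesgue_measure]_x ((expR (a ^+ 2 * s ^+ 2 / 2))%:E *
    (normal_pdf (a * s ^+ 2) s x)%:E)).
  apply: eq_integral => x _; rewrite -!EFinM !normal_pdfE//.
  congr EFin; rewrite /= mulrCA [RHS]mulrCA; congr (_ * _)%R.
  rewrite /normal_fun -!expRD; congr expR.
  by field.
rewrite ge0_integralZl//.
- by rewrite integral_normal_pdf mule1.
- exact: measurable_EFin_normal_pdf.
- by move=> x _; rewrite lee_fin normal_pdf_ge0.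
Qed.

Lemma ge0_integralN (f : R -> \bar R) : measurable_fun setT f ->
  (forall x, 0 <= f x) ->
  \int[lebesgue_measure]_x f (- x)%R = \int[lebesgue_measure]_x f x.
Proof.
move=> mf f0.
transitivity (\int[pushforward lebesgue_measure
   (-%R : R -> measurableTypeR R)]_x f x).
  by rewrite ge0_integral_pushforward.
by apply: eq_measure_integral => A mA _; exact: lebesgue_measureN.
Qed.

(** Serves to exchange the positive and negative parts of a Brownian increment. *)
Lemma ge0_integral_normal_probN (s : R) (f : R -> \bar R) : s != 0%R ->
  measurable_fun setT f -> (forall x, 0 <= f x) ->
  \int[normal_prob 0 s]_x f (- x)%R = \int[normal_prob 0 s]_x f x.
Proof.
move=> s0 mf f0; rewrite !ge0_integral_normal_prob//; last first.
  exact: measurableT_comp.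
rewrite -[RHS]ge0_integralN; last 2 first.
- apply: emeasurable_funM => //.
  exact: measurable_EFin_normal_pdf.
- by move=> x; rewrite mule_ge0// lee_fin normal_pdf_ge0.
apply: eq_integral => x _; congr (_ * _%:E).
by rewrite !normal_pdfE// /normal_fun !subr0 sqrrN.
Qed.

(* [|x| <= s (exp (x / s) + exp (- x / s))] *)
Lemma normal_abs_moment (s : R) : (0 < s)%R ->
  \int[normal_prob 0 s]_x `|x|%:E <= (s * (2 * expR (1 / 2)))%:E.
Proof.
move=> s0.
have sn0 : s != 0%R by rewrite gt_eqF.
have mexp (a : R) : measurable_fun setT (fun x : R => (expR (a * x))%:E).
  by apply/measurable_EFinP/measurableT_comp.
have msum : measurable_fun setT (fun x : R =>
    (expR (s^-1 * x))%:E + (expR (- s^-1 * x))%:E).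
  exact: emeasurable_funD.
apply: (@le_trans _ _ (\int[normal_prob 0 s]_x
    (s%:E * ((expR (s^-1 * x))%:E + (expR (- s^-1 * x))%:E)))).
  apply: ge0_le_integral => //.
  - by apply/measurable_EFinP; exact: normr_measurable.
  - by apply: emeasurable_funM => //; exact: msum.
  move=> x _; rewrite -EFinD -EFinM lee_fin -ler_pdivrMl//.
  have -> : (s^-1 * `|x| = `|s^-1 * x|)%R by rewrite normrM gtr0_norm ?invr_gt0.
  rewrite mulNr; set y := (s^-1 * x)%R.
  have [y0|y0] := leP 0%R y.
  - rewrite ger0_norm// ler_wpDr ?expR_ge0//.
    by apply: le_trans (expR_ge1Dx y); rewrite lerDr.
  - rewrite ltr0_norm// ler_wpDl ?expR_ge0//.
    by apply: le_trans (expR_ge1Dx _); rewrite lerDr.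
rewrite ge0_integralZl//; last 2 first.
- by move=> x _; rewrite -EFinD lee_fin addr_ge0 ?expR_ge0.
- by rewrite lee_fin ltW.
rewrite ge0_integralD//; last 2 first.
- exact: mexp.
- exact: mexp.
rewrite !normal_mgf// -EFinD -EFinM lee_fin.
rewrite sqrrN exprVn mulVf ?expf_neq0//.
by rewrite (mulr_natl _ 2) mulr2n.
Qed.

End normal_moments.

(** * Independence and Fubini *)

Section independent_sigma_algebras.
Context d (T : measurableType d) (R : realType) (P : probability T R).
Variables G H : set (set T).
Hypotheses (Gm : <<s G >> `<=` measurable) (Hm : <<s H >> `<=` measurable).
Hypothesis GH : independent_sigma P <<s G >> <<s H >>.
Local Open Scope ereal_scope.

Let TG : measurableType _ := g_sigma_algebraType G.
Let TH : measurableType _ := g_sigma_algebraType H.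

Lemma measurable_id_g_sigma_algebra (K : set (set T)) :
  <<s K >> `<=` measurable ->
  measurable_fun setT (fun w : T => w : g_sigma_algebraType K).
Proof. by move=> Km _ A mA; rewrite setTI; exact: Km. Qed.

(** The identity from [T] to [TG] is measurable and carries [P] to its restriction to [<<s G>>]; the
    inner integral is the partial integral of Tonelli's theorem for that restriction. *)
Lemma measurable_section_integral (F : TG * TH -> \bar R) :
  measurable_fun setT F -> (forall z, 0 <= F z) ->
  measurable_fun setT (fun v : T => \int[P]_w F (w, v)).
Proof.
move=> mF F0.
have miG := measurable_id_g_sigma_algebra Gm.
have miH := measurable_id_g_sigma_algebra Hm.
pose gG : {mfun T >-> TG} := HB.pack (fun w : T => w : TG)
  (isMeasurableFun.Build _ _ _ _ _ miG).
rewrite (_ : (fun v => _) =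
    (fun v : T => fubini_G (distribution P gG) F (v : TH))).
  by apply: (measurableT_comp (measurable_fun_fubini_tonelli_G F mF F0) miH).
apply/funext => v; rewrite /fubini_G ge0_integral_pushforward//.
exact: measurable_fun_pair1.
Qed.

(* The diagonal map carries [P] to the product of the restrictions of [P] to
   the two sigma-algebras. *)
Lemma independent_sigma_fubini (F : TG * TH -> \bar R) :
  measurable_fun setT F -> (forall z, 0 <= F z) ->
  \int[P]_w F (w, w) = \int[P]_v \int[P]_w F (w, v).
Proof.
move=> mF F0.
have miG := measurable_id_g_sigma_algebra Gm.
have miH := measurable_id_g_sigma_algebra Hm.
pose gG : {mfun T >-> TG} := HB.pack (fun w : T => w : TG)
  (isMeasurableFun.Build _ _ _ _ _ miG).
pose gH : {mfun T >-> TH} := HB.pack (fun w : T => w : TH)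
  (isMeasurableFun.Build _ _ _ _ _ miH).
pose delta (w : T) : TG * TH := (w, w).
have mdelta : measurable_fun setT delta by exact: measurable_fun_pair.
transitivity (\int[pushforward P delta]_z F z).
  by rewrite ge0_integral_pushforward// => z _.
transitivity (\int[distribution P gG \x distribution P gH]_z F z).
  (* On a rectangle the pushforward is the probability of an intersection, so [GH] is exactly the
     product rule that characterises the product measure. *)
  apply: eq_measure_integral => A mA _; apply/esym.
  by apply: product_measure_unique => //.
rewrite fubini_tonelli2// ge0_integral_pushforward//; last 2 first.
- exact: measurable_fun_fubini_tonelli_G.
- by move=> v _; exact: integral_ge0.
apply: eq_integral => v _ /=; rewrite /fubini_G ge0_integral_pushforward//.
exact: measurable_fun_pair1.
Qed.

End independent_sigma_algebras.

(** * Independence: from pi-systems to sigma-algebras and integrals *)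

Section dynkin_independence.
Context d (T : measurableType d) (R : realType) (P : probability T R).
Local Open Scope ereal_scope.

Lemma eq_probability_ae (X Y : set T) : measurable X -> measurable Y ->
  {ae P, forall w, X w <-> Y w} -> P X = P Y.
Proof.
move=> mX mY XY.
transitivity (\int[P]_w (\1_X w)%:E); first by rewrite integral_indic// setIT.
transitivity (\int[P]_w (\1_Y w)%:E); last by rewrite integral_indic// setIT.
apply: ae_eq_integral => //; [exact/measurable_EFinP|exact/measurable_EFinP|].
apply: filterS XY => w XYw _; rewrite /= !indicE; congr (_%:R%:E).
by congr nat_of_bool; apply/idP/idP; rewrite !inE => /XYw.
Qed.

(** As functions of [A], both sides are finite measures: the restriction of [P] to [E], and [P]
    scaled by [P E]. Agreeing on the pi-system [K], they agree on [<<s K>>]. *)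
Lemma independent_g_sigma_algebra (K : set (set T)) (E : set T) :
  K `<=` measurable -> setI_closed K -> K setT -> measurable E ->
  (forall A, K A -> P (A `&` E) = P A * P E) ->
  forall A, <<s K >> A -> P (A `&` E) = P A * P E.
Proof.
move=> Km KI KT mE KE A KA.
have PEfin : P E \is a fin_num by exact: fin_num_measure.
pose r : {nonneg R} := NngNum (fine_ge0 (measure_ge0 P E)).
have -> : P (A `&` E) = mrestr P mE A by [].
have rE C : mscale r P C = P C * P E by rewrite /mscale /r/= fineK// muleC.
rewrite -rE.
apply: (g_sigma_algebra_measure_unique K Km (fun=> setT)) => //.
- by rewrite eqEsubset; split=> // w _; exists 0%N.
- by move=> C KC; rewrite [RHS]rE; exact: KE.
- by move=> _; rewrite (@le_lt_trans _ _ 1%E) ?ltry//;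
  exact/probability_le1/measurableI.
Qed.

(** The integrand is the diagonal of [U w * g (D v)], with [w] seen through [<<s G>>] and [v]
    through the sigma-algebra of [D]; the iterated integral factors. *)
Lemma independent_integralM (G : set (set T)) (D : T -> R)
    (U : g_sigma_algebraType G -> \bar R) (g : R -> \bar R) :
  <<s G >> `<=` measurable -> measurable_fun setT D ->
  (forall A C, <<s G >> A -> measurable C ->
    P (A `&` D @^-1` C) = P A * P (D @^-1` C)) ->
  measurable_fun setT U -> (forall w, 0 <= U w) ->
  measurable_fun setT g -> (forall x, 0 <= g x) ->
  \int[P]_w (U w * g (D w)) = \int[P]_w U w * \int[P]_w g (D w).
Proof.
move=> Gm mD ind mU U0 mg g0.
pose H := preimage_set_system setT D measurable.
have HE : <<s H >> = H.
  by apply: sigma_algebra_id; apply: sigma_algebra_preimage;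
    exact: sigma_algebra_measurable.
have Hm : <<s H >> `<=` measurable.
  by rewrite HE => _ [C mC <-]; exact: mD.
have mDH : measurable_fun setT (D : g_sigma_algebraType H -> R).
  by move=> _ C mC; apply: sub_sigma_algebra; exists C.
have GH : independent_sigma P <<s G >> <<s H >>.
  move=> A B GA; rewrite HE => -[C mC <-]; rewrite setTI; exact: ind.
pose F (z : g_sigma_algebraType G * g_sigma_algebraType H) := U z.1 * g (D z.2).
have mU' : measurable_fun setT (U : T -> \bar R).
  by move=> _ C mC; apply: Gm; exact: mU.
have mgD : measurable_fun setT (fun w : g_sigma_algebraType H => g (D w)).
  exact: measurableT_comp.
rewrite [LHS](independent_sigma_fubini Gm Hm GH (F := F)).
- under eq_integral => v _.
    rewrite /F/= ge0_integralZr//.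
  over.
  rewrite ge0_integralZl//.
  + by apply: measurableT_comp.
  + exact: integral_ge0.
- apply: emeasurable_funM.
  + by apply: (measurableT_comp mU).
  + by apply: (measurableT_comp mgD).
- by move=> z; exact: mule_ge0.
Qed.

End dynkin_independence.

(** * Brownian motion *)

Section brownian_increments.
Context d (T : measurableType d) (R : realType) (P : probability T R).
Variable B : R -> T -> R.
Hypothesis B_brownian : is_brownian_motion P B.
Local Open Scope ereal_scope.

Local Notation F := (natural_filtration `[0%R, +oo[ B).

Lemma brownian_process (t : R) : (0 <= t)%R -> measurable_fun setT (B t).
Proof. by case: B_brownian => + _ _ _ _; exact. Qed.

Lemma brownian0 : {ae P, forall w, B 0%R w = 0%R}.
Proof. by case: B_brownian. Qed.

Lemma sigma_process_measurable (I : set R) (X : R -> T -> R) :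
  (forall t, I t -> measurable_fun setT (X t)) ->
  sigma_process I X `<=` measurable.
Proof.
move=> mX; apply: smallest_sub; first exact: sigma_algebra_measurable.
by move=> _ [t It [C mC <-]]; exact: mX.
Qed.

Lemma sigma_process_preimage (I : set R) (X : R -> T -> R) (t : R) (C : set R) :
  I t -> measurable C -> sigma_process I X (X t @^-1` C).
Proof.
by move=> It mC; apply: sub_sigma_algebra; exists t => //;
  exists C => //; rewrite setTI.
Qed.

Lemma brownian_filtration_measurable (v : R) : F v `<=` measurable.
Proof.
apply: sigma_process_measurable => t [+ _].
by rewrite /= in_itv/= andbT => /brownian_process.
Qed.

Let cylinder (s : seq R) (A : R -> set R) : set T :=
  [set w | forall u, u \in s -> A u (B u w)].

(** Independence of increments is given along one nondecreasing sequence of times, so the times of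
    [s] are sorted, preceded by [0] and followed by [v] and [t]. The last increment is then
    [B t - B v], and the earlier ones determine every [B u - B 0] with [u] in [s]. *)
Lemma brownian_cylinder_independent (s : seq R) (A : R -> set R) (v t : R)
    (C : set R) :
  (forall u, u \in s -> 0 <= u <= v)%R -> (0 <= v)%R -> (v <= t)%R ->
  (forall u, measurable (A u)) -> measurable C ->
  P (cylinder s A `&` (fun w => B t w - B v w)%R @^-1` C) =
  P (cylinder s A) * P ((fun w => B t w - B v w)%R @^-1` C).
Proof.
move=> s_le v0 vt mA mC.
have t0 : (0 <= t)%R by exact: le_trans vt.
pose q := sort <=%R s.
have qs u : (u \in q) = (u \in s) by rewrite mem_sort.
pose L := rcons (rcons q v) t.
have sortedL : path <=%R 0%R L.
  rewrite /L rcons_path last_rcons vt andbT rcons_path.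
  apply/andP; split.
    rewrite path_min_sorted; first exact: sort_le_sorted.
    by apply/allP => u; rewrite qs => /s_le/andP[].
  have : last 0%R q \in 0%R :: q by exact: mem_last.
  by rewrite inE qs => /orP[/eqP ->//|/s_le/andP[]].
pose tau i := nth 0%R (0%R :: L) i.
have sizeL : size L = (size s).+2 by rewrite !size_rcons size_sort.
have tau_le i : (i < (size s).+2)%N -> (tau i <= tau i.+1)%R.
  by move=> ilt; move/(pathP 0%R) : sortedL => /(_ i); rewrite sizeL; apply.
have tau0 : tau 0%N = 0%R by [].
have tau_ge0 i : (0 <= tau i)%R.
  rewrite /tau; have [ilt|ige] := ltnP i (size (0%R :: L)); last first.
    by rewrite nth_default.
  have := mem_nth 0%R ilt; rewrite inE => /orP[/eqP -> //|].
  have /allP := order_path_min le_trans sortedL; exact.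
have tau_v : tau (size s).+1 = v.
  by rewrite /tau/= /L nth_rcons size_rcons size_sort ltnSn nth_rcons size_sort
    ltnn eqxx.
have tau_t : tau (size s).+2 = t.
  by rewrite /tau/= /L nth_rcons size_rcons size_sort ltnn eqxx.
have tau_s u : u \in s -> exists2 j, (j <= (size s))%N & tau j.+1 = u.
  rewrite -qs => us; exists (index u q).
    by rewrite ltnW// -(size_sort <=%R) index_mem.
  rewrite /tau/= /L nth_rcons size_rcons ltnS ltnW ?index_mem//.
  by rewrite nth_rcons index_mem us nth_index.
set n := (size s).+2 in tau_le sizeL tau_t.
pose D (i : 'I_n) w := (B (tau i.+1) w - B (tau i) w)%R.
have mD i : measurable_fun setT (D i).
  by apply: measurable_funB; exact: brownian_process.
have indD : mutually_independent P D.
  case: B_brownian => _ _ ind _ _; exact: ind.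
have Dmax w : (B t w - B v w)%R = D ord_max w.
  by rewrite /D/= tau_v tau_t.
(* The condition [A ord_max = setT] leaves the increment from [v] to [t] free: [K] is a pi-system of
   events on the earlier increments. *)
pose K : set (set T) := [set X | exists A : 'I_n -> set R,
  [/\ forall i, measurable (A i), A ord_max = setT &
      X = \bigcap_i (D i @^-1` A i)]].
have mcap (A' : 'I_n -> set R) : (forall i, measurable (A' i)) ->
    measurable (\bigcap_i (D i @^-1` A' i)).
  move=> mA'; apply: fin_bigcap_measurable => // i _.
  by rewrite -[X in measurable X]setTI; exact: mD.
have Km : K `<=` measurable by move=> _ [A' [mA' _ ->]]; exact: mcap.
have mE : measurable ((fun w => B t w - B v w)%R @^-1` C).
  rewrite -[X in measurable X]setTI.
  by apply: measurable_funB => //; exact: brownian_process.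
have KI : setI_closed K.
  move=> _ _ [A1 [mA1 A1T ->]] [A2 [mA2 A2T ->]].
  exists (fun i => A1 i `&` A2 i); split.
  - by move=> i; exact: measurableI.
  - by rewrite A1T A2T setTI.
  - by rewrite -bigcapI.
have KT : K setT.
  exists (fun=> setT); split => //.
  by apply/esym; rewrite -subTset => w _ i _.
have KE X : K X -> P (X `&` (fun w => B t w - B v w)%R @^-1` C) =
    P X * P ((fun w => B t w - B v w)%R @^-1` C).
  move=> [A' [mA' A'T ->]].
  pose A2 i := if i == ord_max then C else A' i.
  have mA2 i : measurable (A2 i) by rewrite /A2; case: ifPn.
  rewrite (_ : _ `&` _ = \bigcap_i (D i @^-1` A2 i)); last first.
    apply/seteqP; split => w /=.
      move=> [Aw Cw] i _; rewrite /A2; have [->|_] := eqVneq i ord_max.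
        by rewrite /= -Dmax.
      exact: Aw.
    move=> Aw; split.
      move=> i _; have := Aw i I; rewrite /A2/=.
      by have [-> _|//] := eqVneq i ord_max; rewrite A'T.
    by have := Aw ord_max I; rewrite /A2/= eqxx -Dmax.
  rewrite !indD// (bigD1 ord_max)//= [in RHS](bigD1 ord_max)//=.
  rewrite A'T preimage_setT probability_setT mul1e muleC; congr (_ * _).
    by apply: eq_bigr => i /negbTE imax; rewrite /A2 imax.
  rewrite /A2 eqxx; congr (P _); apply/seteqP; split => w /=; by rewrite -Dmax.
have sKE := independent_g_sigma_algebra Km KI KT mE KE.
(* Increments do not see [B 0], which is [0] only almost surely; the cylinder is therefore replaced
   by one on [B u - B 0], equal to it up to a null event. *)
pose cyl' : set T := [set w | forall u, u \in s -> A u (B u w - B 0%R w)%R].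
have sKcyl' : <<s K >> cyl'.
  pose TK : measurableType _ := g_sigma_algebraType K.
  have mDK (i : 'I_n) : (i < (size s).+1)%N ->
      measurable_fun setT (D i : TK -> R).
    move=> ilt _ Y mY; rewrite setTI; apply: sub_sigma_algebra.
    exists (fun j => if j == i then Y else setT); split.
    - by move=> j; case: ifPn.
    - by case: eqP => // -[/= ni]; move: ilt; rewrite -ni ltnn.
    - apply/seteqP; split => [w /= Yw j _|w /(_ i I)/=].
        by have [->|_] := eqVneq j i.
      by rewrite eqxx.
  have mBK u : u \in s ->
      measurable_fun setT ((fun w => B u w - B 0 w)%R : TK -> R).
    (* [B u - B 0] telescopes into increments of index at most [size s], all before [ord_max], whose
       index is [(size s).+1]. *)
    move=> /tau_s[j js <-].
    rewrite (_ : (fun w => _) = (fun w => \sum_(i < j.+1)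
        (B (tau i.+1) w - B (tau i) w))%R); last first.
      apply/funext => w.
      rewrite -(big_mkord xpredT (fun i => B (tau i.+1) w - B (tau i) w)%R).
      by rewrite telescope_sumr.
    apply: measurable_sum => i.
    have ilt : (i < (size s).+1)%N by rewrite (leq_trans (ltn_ord i)).
    have iltn : (i < n)%N by rewrite ltnW.
    exact: (mDK (Ordinal iltn)).
  have -> : cyl' = \bigcap_(u in [set` s])
      ((fun w => B u w - B 0 w)%R @^-1` A u).
    by apply/seteqP; split => w /= h u; exact: h.
  apply: (@fin_bigcap_measurable _ TK) => //.
  move=> u us; rewrite -[X in measurable X]setTI; exact: mBK.
have mcyl : measurable (cylinder s A).
  rewrite (_ : cylinder s A = \bigcap_(u in [set` s]) (B u @^-1` A u)).
    apply: fin_bigcap_measurable => // u us; rewrite -[X in measurable X]setTI.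
    by apply: brownian_process => //; have /andP[] := s_le u us.
  by apply/seteqP; split => w /= h u; exact: h.
have mcyl' : measurable cyl'.
  by move: sKcyl'; apply: smallest_sub => //; exact: sigma_algebra_measurable.
have cylE : {ae P, forall w, cylinder s A w <-> cyl' w}.
  apply: filterS brownian0 => w Bw0; rewrite /cylinder /cyl'/= Bw0.
  by split => h u /h; rewrite subr0.
rewrite (eq_probability_ae mcyl mcyl' cylE).
rewrite -sKE//; apply: eq_probability_ae; [exact: measurableI..|].
apply: filterS cylE => w cylw; split => -[/cylw ? ?]; split => //.
Qed.

(** Cylinders over finitely many times in [[0, v]] form a pi-system that generates [F v]. *)
Lemma brownian_increment_independent (v t : R) (A : set T) (C : set R) :
  (0 <= v)%R -> (v <= t)%R -> F v A -> measurable C ->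
  P (A `&` (fun w => B t w - B v w)%R @^-1` C) =
  P A * P ((fun w => B t w - B v w)%R @^-1` C).
Proof.
move=> v0 vt FA mC.
have t0 : (0 <= t)%R by exact: le_trans vt.
pose K : set (set T) := [set X | exists s A,
  [/\ forall u, u \in s -> (0 <= u <= v)%R, forall u, measurable (A u) &
      X = cylinder s A]].
have Km : K `<=` measurable.
  move=> _ [s [X [sv mX ->]]].
  rewrite (_ : cylinder s X = \bigcap_(u in [set` s]) (B u @^-1` X u)).
    apply: fin_bigcap_measurable => // u us; rewrite -[Y in measurable Y]setTI.
    by apply: brownian_process => //; have /andP[] := sv u us.
  by apply/seteqP; split => w /= h u; exact: h.
apply: (independent_g_sigma_algebra (K := K)) => //.
(* The lists of times are concatenated; a time absent from one list is unconstrained there, hence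
   [setT]. *)
- move=> _ _ [s1 [A1 [sv1 mA1 ->]]] [s2 [A2 [sv2 mA2 ->]]].
  exists (s1 ++ s2), (fun u => (if u \in s1 then A1 u else setT) `&`
    (if u \in s2 then A2 u else setT)); split.
  + by move=> u; rewrite mem_cat => /orP[/sv1|/sv2].
  + by move=> u; apply: measurableI; case: ifPn.
  + apply/seteqP; split => w /=.
      move=> [h1 h2] u _; split.
        by case: ifPn => // /h1.
      by case: ifPn => // /h2.
    move=> h; split => u us; have := h u; rewrite mem_cat us ?orbT => /(_ isT).
      by case.
    by case.
- exists [::], (fun=> setT); split => //.
  by apply/esym; rewrite -subTset.
- rewrite -[X in measurable X]setTI.
  by apply: measurable_funB => //; exact: brownian_process.
- by move=> _ [s [X [sv mX ->]]]; exact: brownian_cylinder_independent.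
- move: FA; apply: sub_sigma_algebra2 => _ [u [/= + uv] [Y mY <-]].
  rewrite in_itv/= andbT => u0.
  exists [:: u], (fun=> Y); split => //.
    by move=> x; rewrite inE => /eqP ->; rewrite u0.
  rewrite setTI; apply/seteqP; split => w /=.
    by move=> ? x; rewrite inE => /eqP ->.
  by apply; rewrite inE.
Qed.

End brownian_increments.

(** * Moments and martingale identities of Brownian motion at deterministic times *)

Section brownian_integrals.
Context d (T : measurableType d) (R : realType) (P : probability T R).
Variable B : R -> T -> R.
Hypothesis B_brownian : is_brownian_motion P B.
Local Open Scope ereal_scope.

Local Notation F := (natural_filtration `[0%R, +oo[ B).

Lemma brownian_filtrationS (v t : R) : (v <= t)%R -> F v `<=` F t.
Proof.
move=> vt; apply: sub_sigma_algebra2; apply: bigcup_subset => u [/= u0 uv].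
by split => //=; exact: le_trans vt.
Qed.

Lemma brownian_increment_integral (v t : R) (D : set T) (u g : R -> R) :
  (0 <= v)%R -> (v <= t)%R -> F v D ->
  measurable_fun setT u -> (forall x, (0 <= u x)%R) ->
  measurable_fun setT g -> (forall x, (0 <= g x)%R) ->
  \int[P]_(w in D) (u (B v w) * g (B t w - B v w))%:E =
  \int[P]_(w in D) (u (B v w))%:E * \int[P]_w (g (B t w - B v w)%R)%:E.
Proof.
move=> v0 vt FD mu u0 mg g0.
have mD := brownian_filtration_measurable B_brownian FD.
pose G := \bigcup_(s in `[0%R, +oo[ `&` [set s | (s <= v)%R])
  preimage_set_system setT (B s) measurable.
have mBv : measurable_fun setT (B v : g_sigma_algebraType G -> R).
  move=> _ C mC; rewrite setTI.
  apply: (@sigma_process_preimage _ _ _ _ B v C) => //.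
  by split => //=; rewrite in_itv/= v0.
rewrite integral_mkcond [in RHS]integral_mkcond !epatch_indic.
rewrite -[RHS](independent_integralM (P := P) (G := G)
  (D := fun w => (B t w - B v w)%R)
  (U := fun w => (u (B v w))%:E * (\1_D w)%:E) (g := EFin \o g)).
- by apply: eq_integral => w _ /=; rewrite EFinM muleAC.
- exact: (@brownian_filtration_measurable _ _ _ _ _ B_brownian v).
- apply: measurable_funB; apply: (brownian_process B_brownian) => //.
  exact: le_trans vt.
- by move=> A C FA mC; exact: brownian_increment_independent.
- apply: emeasurable_funM; apply/measurable_EFinP.
    by apply: (measurableT_comp mu).
  exact: measurable_indic.
- by move=> w; rewrite mule_ge0// lee_fin.
- exact/measurable_EFinP.
- by move=> x; rewrite lee_fin.
Qed.

Lemma brownian_increment_law (v t : R) (g : R -> \bar R) :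
  (0 <= v)%R -> (v < t)%R -> measurable_fun setT g -> (forall x, 0 <= g x) ->
  \int[P]_w g (B t w - B v w)%R = \int[normal_prob 0 (Num.sqrt (t - v))]_x g x.
Proof.
move=> v0 vt mg g0.
have mD : measurable_fun setT (fun w => B t w - B v w)%R.
  apply: measurable_funB; apply: (brownian_process B_brownian) => //.
  by rewrite (le_trans v0)// ltW.
transitivity (\int[pushforward P
    (fun w => (B t w - B v w)%R : measurableTypeR R)]_x g x).
  by rewrite ge0_integral_pushforward.
apply: eq_measure_integral => C mC _.
by case: B_brownian => _ _ _ law _; exact: law.
Qed.

Lemma brownian_increment_mgf (v t a : R) : (0 <= v)%R -> (v <= t)%R ->
  \int[P]_w (expR (a * (B t w - B v w)))%:E = (expR (a ^+ 2 * (t - v) / 2))%:E.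
Proof.
(* The Gaussian law is given for [v < t] only; at [v = t] the increment is identically [0]. *)
move=> v0; rewrite le_eqVlt => /orP[/eqP <-|vt].
  under eq_integral do rewrite subrr mulr0 expR0.
  rewrite integral_cst// subrr mulr0 mul0r expR0 mul1e; exact: probability_setT.
rewrite (@brownian_increment_law _ _ (fun x => (expR (a * x))%:E))//.
- by rewrite normal_mgf ?sqr_sqrtr ?subr_ge0 ?ltW// gt_eqF// sqrtr_gt0 subr_gt0.
- by apply/measurable_EFinP/measurableT_comp => //; exact: measurable_funM.
Qed.

Lemma brownian_exp_shift (v t a b : R) (D : set T) :
  (0 <= v)%R -> (v <= t)%R -> F v D ->
  \int[P]_(w in D) (expR (a * B v w + b * (B t w - B v w)))%:E =
  \int[P]_(w in D) (expR (a * B v w))%:E * (expR (b ^+ 2 * (t - v) / 2))%:E.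
Proof.
move=> v0 vt FD; rewrite -brownian_increment_mgf//.
rewrite -(brownian_increment_integral (u := fun x => expR (a * x))
  (g := fun x => expR (b * x)))//.
- by apply: eq_integral => w _; rewrite expRD.
- by apply: measurableT_comp => //; exact: measurable_funM.
- by apply: measurableT_comp => //; exact: measurable_funM.
Qed.

Lemma natural_filtrationT (v : R) : F v setT.
Proof.
rewrite /natural_filtration /sigma_process; set G := \bigcup_(_ in _) _.
exact: (@measurableT _ (g_sigma_algebraType G)).
Qed.

Lemma brownian_mgf (t a : R) : (0 <= t)%R ->
  \int[P]_w (expR (a * B t w))%:E = (expR (a ^+ 2 * t / 2))%:E.
Proof.
move=> t0; rewrite -[in RHS](subr0 t) -(brownian_increment_mgf a (lexx 0%R) t0).
have m1 s : (0 <= s)%R -> measurable_fun setT (fun w => a * B s w)%R.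
  by move=> s0; apply: measurable_funM => //; exact: (brownian_process B_brownian).
apply: ae_eq_integral => //.
- by apply/measurable_EFinP/measurableT_comp => //; exact: m1.
- apply/measurable_EFinP/measurableT_comp => //; apply: measurable_funM => //.
  by apply: measurable_funB => //; exact: (brownian_process B_brownian).
- by apply: filterS (brownian0 B_brownian) => w Bw _; rewrite Bw subr0.
Qed.

Lemma brownian_exp_martingale (v t : R) (D : set T) :
  (0 <= v)%R -> (v <= t)%R -> F v D ->
  \int[P]_(w in D) (expR (B t w - 1 / 2 * t))%:E =
  \int[P]_(w in D) (expR (B v w - 1 / 2 * v))%:E.
Proof.
move=> v0 vt FD; have t0 : (0 <= t)%R by exact: le_trans vt.
have mD := brownian_filtration_measurable B_brownian FD.
have mB s : (0 <= s)%R -> measurable_fun D (fun w => (expR (1 * B s w))%:E).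
  move=> s0; apply/measurable_funTS/measurable_EFinP/measurableT_comp => //.
  by apply: measurable_funM => //; exact: (brownian_process B_brownian).
have e s : (0 <= s)%R -> \int[P]_(w in D) (expR (B s w - 1 / 2 * s))%:E =
    \int[P]_(w in D) (expR (1 * B s w))%:E * (expR (- (1 / 2 * s)))%:E.
  move=> s0; rewrite -ge0_integralZr//; last first.
  - exact: mB.
  by apply: eq_integral => w _; rewrite -EFinM -expRD; congr (expR _)%:E; field.
rewrite (e _ t0) (e _ v0).
have := brownian_exp_shift 1 1 v0 vt FD.
rewrite [in LHS](eq_integral (fun w => (expR (1 * B t w))%:E)); last first.
  by move=> w _; congr (expR _)%:E; ring.
move=> ->; rewrite -muleA -EFinM -expRD; congr (_ * (expR _)%:E).
by field.
Qed.

(** Two uses of [brownian_exp_shift]: the increment from [t] to [r] with weight [-1/2] gives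
    [exp ((r - t) / 8)], the one from [v] to [t] with weight [1/2] gives [exp ((t - v) / 8)]. In the
    product [t] disappears, so the same lemma at [t = v] yields the martingale identity. *)
Lemma brownian_tilted (v t r : R) (D : set T) :
  (0 <= v)%R -> (v <= t)%R -> (t <= r)%R -> F v D ->
  \int[P]_(w in D) (expR (B t w - 1 / 2 * B r w))%:E =
  \int[P]_(w in D) (expR (1 / 2 * B v w))%:E * (expR ((r - v) / 8))%:E.
Proof.
move=> v0 vt tr FD; have t0 : (0 <= t)%R by exact: le_trans vt.
rewrite (eq_integral (fun w =>
  (expR (1 / 2 * B t w + (- (1 / 2)) * (B r w - B t w)))%:E)); last first.
  by move=> w _; congr (expR _)%:E; field.
rewrite brownian_exp_shift//; last exact: brownian_filtrationS FD.
rewrite (eq_integral (fun w =>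
  (expR (1 / 2 * B v w + (1 / 2) * (B t w - B v w)))%:E)); last first.
  by move=> w _; congr (expR _)%:E; field.
rewrite brownian_exp_shift// -muleA -EFinM -expRD; congr (_ * (expR _)%:E).
by field.
Qed.

Lemma brownian_tilted_martingale (v t r k : R) (D : set T) :
  (0 <= v)%R -> (v <= t)%R -> (t <= r)%R -> F v D ->
  \int[P]_(w in D) (expR (B t w) * expR (- (1 / 2 * B r w) - k * r))%:E =
  \int[P]_(w in D) (expR (B v w) * expR (- (1 / 2 * B r w) - k * r))%:E.
Proof.
move=> v0 vt tr FD.
have t0 : (0 <= t)%R by exact: le_trans vt.
have r0 : (0 <= r)%R by exact: le_trans tr.
have mD := brownian_filtration_measurable B_brownian FD.
have e s : (0 <= s)%R ->
    \int[P]_(w in D) (expR (B s w) * expR (- (1 / 2 * B r w) - k * r))%:E =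
    \int[P]_(w in D) (expR (B s w - 1 / 2 * B r w))%:E * (expR (- (k * r)))%:E.
  move=> s0; rewrite -ge0_integralZr//; last first.
  - apply/measurable_funTS/measurable_EFinP/measurableT_comp => //.
    apply: measurable_funB; first exact: (brownian_process B_brownian).
    by apply: measurable_funM => //; exact: (brownian_process B_brownian).
  by apply: eq_integral => w _; rewrite -EFinM -!expRD; congr (expR _)%:E; ring.
rewrite (e _ t0) (e _ v0); congr (_ * _); rewrite (brownian_tilted v0 vt tr FD).
by rewrite (brownian_tilted v0 (lexx _) (le_trans vt tr) FD).
Qed.

Lemma brownian_tilted_mass (t r k : R) : (0 <= t)%R -> (t <= r)%R ->
  \int[P]_w (expR (B t w) * expR (- (1 / 2 * B r w) - k * r))%:E =
  (expR ((1 / 8 - k) * r))%:E.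
Proof.
move=> t0 tr; have r0 : (0 <= r)%R by exact: le_trans tr.
have FT : F 0%R setT by exact: natural_filtrationT.
transitivity (\int[P]_w (expR (B t w - 1 / 2 * B r w))%:E * (expR (- (k * r)))%:E).
  rewrite -ge0_integralZr//; last first.
  - apply/measurable_EFinP/measurableT_comp => //.
    apply: measurable_funB; first exact: (brownian_process B_brownian).
    by apply: measurable_funM => //; exact: (brownian_process B_brownian).
  by apply: eq_integral => w _; rewrite -EFinM -!expRD; congr (expR _)%:E; ring.
rewrite (brownian_tilted (lexx _) t0 tr FT) brownian_mgf// -!EFinM -!expRD.
by congr (expR _)%:E; field.
Qed.

Lemma brownian_density_mass (r k : R) : (0 <= r)%R ->
  \int[P]_w (expR (- (1 / 2 * B r w) - k * r))%:E =
  (expR ((1 / 8 - k) * r))%:E.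
Proof.
move=> r0.
transitivity (\int[P]_w (expR ((- (1 / 2)) * B r w))%:E * (expR (- (k * r)))%:E).
  rewrite -ge0_integralZr//; last first.
  - apply/measurable_EFinP/measurableT_comp => //.
    by apply: measurable_funM => //; exact: (brownian_process B_brownian).
  by apply: eq_integral => w _; rewrite -EFinM -!expRD; congr (expR _)%:E; ring.
by rewrite brownian_mgf// -!EFinM -!expRD; congr (expR _)%:E; field.
Qed.

Lemma brownian_exp_mass (t : R) : (0 <= t)%R ->
  \int[P]_w (expR (B t w - 1 / 2 * t))%:E = 1.
Proof.
move=> t0.
transitivity (\int[P]_w (expR (1 * B t w))%:E * (expR (- (1 / 2 * t)))%:E).
  rewrite -ge0_integralZr//; last first.
  - apply/measurable_EFinP/measurableT_comp => //.
    by apply: measurable_funM => //; exact: (brownian_process B_brownian).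
  by apply: eq_integral => w _; rewrite -EFinM -!expRD; congr (expR _)%:E; ring.
by rewrite brownian_mgf// -EFinM -expRD (_ : _ + _ = 0)%R ?expR0//; field.
Qed.

Lemma brownian_abs_moment (t : R) : (0 <= t)%R ->
  \int[P]_w `|B t w|%:E <= (2 * expR (1 / 2) * (1 + t))%:E.
Proof.
move=> t0; have mB s : (0 <= s)%R -> measurable_fun setT (B s).
  exact: (brownian_process B_brownian).
rewrite [leLHS](_ : _ = \int[P]_w `|B t w - B 0%R w|%:E); last first.
  apply: ae_eq_integral => //.
  - by apply/measurable_EFinP/measurableT_comp => //; exact: mB.
  - apply/measurable_EFinP/measurableT_comp => //.
    by apply: measurable_funB; exact: mB.
  - by apply: filterS (brownian0 B_brownian) => w Bw _; rewrite Bw subr0.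
have c0 : (0 <= 2 * expR (1 / 2) :> R)%R by rewrite mulr_ge0 ?expR_ge0.
move: t0; rewrite le_eqVlt => /orP[/eqP <-|t0].
  under eq_integral do rewrite subrr normr0.
  by rewrite integral0 lee_fin mulr_ge0// addr0.
rewrite (@brownian_increment_law _ _ (fun x => `|x|%:E))//; last first.
  by apply/measurable_EFinP; exact: normr_measurable.
rewrite subr0 (le_trans (normal_abs_moment _)) ?sqrtr_gt0// lee_fin mulrC.
(* The bound [sqrt t <= 1 + t] makes the estimate linear in [t], so that a finite mean of the clock
   is enough afterwards. *)
rewrite ler_wpM2l//; set y := Num.sqrt t.
have -> : t = (y ^+ 2)%R by rewrite sqr_sqrtr// ltW.
by have := sqr_ge0 (y - 1); nra.
Qed.

(** This is the martingale identity of [B] over [D] with each negative part on the opposite side: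
    both integrands are nonnegative, as Tonelli requires. *)
Lemma brownian_posneg_martingale (v t : R) (D : set T) :
  (0 <= v)%R -> (v <= t)%R -> F v D ->
  \int[P]_(w in D) (Num.max (B t w) 0 + Num.max (- B v w) 0)%:E =
  \int[P]_(w in D) (Num.max (B v w) 0 + Num.max (- B t w) 0)%:E.
Proof.
move=> v0 vt FD; have t0 : (0 <= t)%R by exact: le_trans vt.
have mD := brownian_filtration_measurable B_brownian FD.
have mB s : (0 <= s)%R -> measurable_fun setT (B s).
  exact: (brownian_process B_brownian).
have mI : measurable_fun setT (fun w => B t w - B v w)%R.
  by apply: measurable_funB; exact: mB.
pose p (x : R) := Num.max x 0%R.
have p0 x : (0 <= p x)%R by rewrite le_max lexx orbT.
have pE x : p x = (x + p (- x))%R.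
  rewrite /p; have [x0|x0] := leP 0%R x.
    by rewrite max_r ?oppr_le0// addr0.
  by rewrite max_l ?oppr_ge0 ?ltW// subrr.
have mp : measurable_fun setT p by exact: measurable_maxr.
(* The increment is independent of [D] and has a symmetric law. *)
have incr : \int[P]_(w in D) (p (B t w - B v w)%R)%:E =
    \int[P]_(w in D) (p (- (B t w - B v w))%R)%:E.
  have h (g : R -> R) : measurable_fun setT g -> (forall x, (0 <= g x)%R) ->
      \int[P]_(w in D) (g (B t w - B v w)%R)%:E =
      \int[P]_(w in D) (cst 1%R (B v w))%:E * \int[P]_w (g (B t w - B v w)%R)%:E.
    move=> mg g0; rewrite -(brownian_increment_integral (u := cst 1%R))//.
    by apply: eq_integral => w _; rewrite /= mul1r.
  have mpN : measurable_fun setT (fun x : R => p (- x)%R).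
    exact: measurableT_comp.
  rewrite h// (h (fun x => p (- x)%R))//; congr (_ * _).
  move: vt; rewrite le_eqVlt => /orP[/eqP ->|vt].
    by apply: eq_integral => w _; rewrite subrr oppr0.
  have mEp : measurable_fun setT (fun x : R => (p x)%:E) by exact/measurable_EFinP.
  have mEpN : measurable_fun setT (fun x : R => (p (- x)%R)%:E).
    exact/measurable_EFinP.
  rewrite (brownian_increment_law v0 vt mEp); last by move=> x; rewrite lee_fin.
  rewrite (brownian_increment_law v0 vt mEpN); last by move=> x; rewrite lee_fin.
  rewrite (ge0_integral_normal_probN (f := fun x => (p x)%:E))//.
  by rewrite gt_eqF// sqrtr_gt0 subr_gt0.
(* Finiteness is what allows this term to be cancelled from both sides of [key]. *)
have fin : \int[P]_(w in D) (p (B t w - B v w)%R)%:E < +oo.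
  apply: (@le_lt_trans _ _ (\int[P]_w (`|B t w|%:E + `|B v w|%:E))).
    apply: (@le_trans _ _ (\int[P]_w (p (B t w - B v w)%R)%:E)).
      apply: ge0_subset_integral => //.
      - by apply/measurable_EFinP; exact: measurableT_comp.
      - by move=> w _; rewrite lee_fin.
    apply: ge0_le_integral => //.
    - by move=> w _; rewrite lee_fin.
    - by apply/measurable_EFinP; exact: measurableT_comp.
    - by apply: emeasurable_funD; apply/measurable_EFinP/measurableT_comp => //;
        exact: mB.
    - move=> w _; rewrite -EFinD lee_fin /p ge_max addr_ge0// andbT.
      by rewrite (le_trans (ler_norm _))// ler_normB.
  rewrite ge0_integralD//; last 2 first.
  - by apply/measurable_EFinP/measurableT_comp => //; exact: mB.
  - by apply/measurable_EFinP/measurableT_comp => //; exact: mB.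
  by apply: lte_add_pinfty; apply: le_lt_trans (brownian_abs_moment _) (ltry _).
have mpB (s u : R) : (0 <= s)%R -> (0 <= u)%R ->
    measurable_fun D (fun w => (p (B s w) + p (- B u w))%:E).
  move=> s0 u0; apply/measurable_funTS/measurable_EFinP/measurable_funD.
    by apply: measurableT_comp => //; exact: mB.
  by do 2 apply: measurableT_comp => //; exact: mB.
have mpI : measurable_fun D (fun w => (p (B t w - B v w)%R)%:E).
  by apply/measurable_funTS/measurable_EFinP/measurableT_comp.
have mpIN : measurable_fun D (fun w => (p (- (B t w - B v w))%R)%:E).
  by apply/measurable_funTS/measurable_EFinP; do 2 apply: measurableT_comp => //.
have [fin1 fin2] : \int[P]_(w in D) (p (B t w - B v w)%R)%:E \is a fin_num /\
   0 <= \int[P]_(w in D) (p (B t w - B v w)%R)%:E.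
  have i0 : 0 <= \int[P]_(w in D) (p (B t w - B v w)%R)%:E.
    by apply: integral_ge0 => w _; rewrite lee_fin.
  by split => //; rewrite ge0_fin_numE.
(* With [x+ = max x 0], [b+ + a- + (b - a)- = a+ + b- + (b - a)+]. *)
have key : \int[P]_(w in D) (p (B t w) + p (- B v w))%:E +
    \int[P]_(w in D) (p (- (B t w - B v w))%R)%:E =
    \int[P]_(w in D) (p (B v w) + p (- B t w))%:E +
    \int[P]_(w in D) (p (B t w - B v w)%R)%:E.
  rewrite -!ge0_integralD//; try by [exact: mpB|
    move=> w _; rewrite lee_fin ?addr_ge0|move=> w _; rewrite lee_fin].
  apply: eq_integral => w _; rewrite -!EFinD; congr EFin.
  by rewrite (pE (B t w)) (pE (B v w)) (pE (B t w - B v w)%R); ring.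
rewrite -incr in key.
by rewrite -[LHS](addeK _ fin1) key addeK.
Qed.

End brownian_integrals.

(** * Inverse subordinators *)

Section levy_exponent.
Context {R : realType}.
Variable nu : {measure set (measurableTypeR R) -> \bar R}.
Hypotheses (nu_levy : is_levy_measure nu).
Hypothesis nu_infinite : nu `]0%R, +oo[%classic = +oo%E.
Local Open Scope ereal_scope.

(** If the integral vanished, its integrand, positive on the half-line, would be [0] almost
    everywhere and the half-line would be [nu]-null. *)
Lemma laplace_exponent1_gt0 : (0 < laplace_exponent nu 1)%R.
Proof.
pose f (x : R) : \bar R := (1 - expR (- (1 * x)))%:E.
have mf : measurable_fun (`]0%R, +oo[%classic : set (measurableTypeR R)) f.
  apply/measurable_funTS/measurable_EFinP/measurable_funB => //.
  by apply/measurableT_comp => //; apply/measurableT_comp => //;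
    exact: measurable_funM.
have f0 (x : R) : (0 < x)%R -> (0 < 1 - expR (- (1 * x)))%R.
  by move=> x0; rewrite subr_gt0 mul1r expR_lt1 oppr_lt0.
have fge0 x : x \in (`]0%R, +oo[%classic : set R) -> 0 <= f x.
  by rewrite inE/= in_itv/= andbT => x0; rewrite lee_fin ltW// f0.
have I0 : 0 <= \int[nu]_(x in `]0%R, +oo[) f x.
  by apply: integral_ge0 => x x0; apply: fge0; rewrite inE.
(* [laplace_exponent] is the [fine] of this integral, and [fine +oo = 0]; finiteness follows from
   [1 - exp (- x) <= min 1 x]. *)
have Ioo : \int[nu]_(x in `]0%R, +oo[) f x < +oo.
  apply: le_lt_trans nu_levy; apply: ge0_le_integral => //.
  - by move=> x x0; apply: fge0; rewrite inE.
  - by apply/measurable_funTS/measurable_EFinP; exact: measurable_minr.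
  - move=> x; rewrite /= in_itv/= andbT => x0; rewrite lee_fin le_min.
    rewrite gerBl ?expR_ge0//= mul1r lerBlDr addrC -lerBlDr.
    by have := expR_ge1Dx (- x); lra.
rewrite /laplace_exponent /Rintegral fine_gt0// Ioo andbT lt_neqAle I0 andbT.
apply/eqP => /esym I1.
have : ae_eq nu (`]0%R, +oo[%classic : set (measurableTypeR R)) f (cst 0).
  apply/(ae_eq_integral_abs nu _ mf) => //.
  by rewrite -[RHS]I1; apply: eq_integral => x /fge0 fx; rewrite gee0_abs.
move=> [N [mN N0 fN]].
have : nu `]0%R, +oo[%classic <= nu N.
  apply: le_measure; rewrite ?inE// => x x0; apply: fN => /(_ x0)/eqP.
  move: x0; rewrite /= in_itv/= andbT => /f0 x0.
  by rewrite /f eqe gt_eqF.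
by rewrite N0 nu_infinite.
Qed.

End levy_exponent.

(** * Pathwise properties of the inverse *)

Section inverse_subordinator_paths.
Context (T : Type) (R : realType) (Tf : R -> T -> R).
Hypothesis Tf_nd : forall w s t, 0 <= s -> s <= t -> Tf s w <= Tf t w.

Local Notation S := (inverse_subordinator Tf).
Local Notation above t w := [set tau : R | 0 < tau /\ t < Tf tau w].

Lemma above_lbound t w : has_lbound (above t w).
Proof. by exists 0 => tau [/ltW]. Qed.

Lemma inverse_subordinator_ge0 t w : 0 <= S t w.
Proof.
rewrite /inverse_subordinator.
have [->|/set0P ne] := eqVneq (above t w) set0; first by rewrite inf0.
by apply: lb_le_inf => // tau [/ltW].
Qed.

Lemma inverse_subordinator_le t w tau : 0 < tau -> t < Tf tau w -> S t w <= tau.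
Proof. by move=> tau0 tT; apply: (ge_inf (above_lbound t w)). Qed.

Lemma inverse_subordinator_neq0 t w : 0 < S t w -> above t w !=set0.
Proof.
rewrite /inverse_subordinator => S0; apply/set0P/eqP => E.
by move: S0; rewrite E inf0 ltxx.
Qed.

(** The time [n] may be [0], which the infimum excludes; hence the detour through a [tau] strictly
    between [n] and [S t w]. *)
Lemma subordinator_le n t w : 0 <= n -> n < S t w -> Tf n w <= t.
Proof.
move=> n0 nS; have [tau /andP[ntau tauS]] : exists tau, n < tau < S t w.
  by exists ((n + S t w) / 2); rewrite !midf_lt.
apply: le_trans (Tf_nd w n0 (ltW ntau)) _; rewrite leNgt; apply/negP => tT.
by move: tauS; rewrite ltNge inverse_subordinator_le// (le_lt_trans n0).
Qed.

(* Where the set of [inverse_subordinator] is empty at some time, the junk value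
   [0] breaks monotonicity, hence the hypothesis [0 < S u w]. *)
Lemma inverse_subordinator_nd s t u w : s <= t -> t <= u -> 0 < S u w ->
  S s w <= S t w.
Proof.
move=> st tu /inverse_subordinator_neq0[tau [tau0 uT]].
apply: lb_le_inf; first by exists tau; split => //; exact: le_lt_trans uT.
move=> tau' [tau'0 tT]; apply: inverse_subordinator_le => //.
exact: le_lt_trans tT.
Qed.

(** A countable description, for measurability. The first alternative is the empty set, where the
    clock is [0]; monotonicity lets integer times detect it. In the second, monotonicity lets a
    rational time replace the real one. *)
Lemma inverse_subordinator_lt t w a :
  S t w < a <-> (0 < a /\ forall n : nat, Tf n.+1%:R w <= t) \/
    exists2 q : rat, 0 < (ratr q : R) < a & t < Tf (ratr q) w.
Proof.
split.
- have [E Sa|/set0P ne Sa] := eqVneq (above t w) set0.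
    left; split; first by move: Sa; rewrite /inverse_subordinator E inf0.
    move=> n; rewrite leNgt; apply/negP => tT.
    by have : above t w n.+1%:R by []; rewrite E.
  right; have [tau [tau0 tT] taua] := inf_lt ne Sa.
  have [q] := rat_in_itvoo taua; rewrite in_itv/= => /andP[tauq qa].
  exists q; first by rewrite qa andbT (lt_trans tau0).
  by apply: (lt_le_trans tT); apply: Tf_nd; exact: ltW.
- move=> [[a0 h]|[q /andP[q0 qa] tT]]; last first.
    exact: le_lt_trans (inverse_subordinator_le q0 tT) qa.
  rewrite /inverse_subordinator (_ : above t w = set0) ?inf0//.
  rewrite -subset0 => tau [tau0]; apply/negP; rewrite -leNgt.
  apply: le_trans (h (Num.truncn tau)); apply: Tf_nd; first exact: ltW.
  exact/ltW/truncnS_gt.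
Qed.

End inverse_subordinator_paths.

(** * Measurability, mean and positivity of the clock *)

Section inverse_subordinator_law.
Context d (T : measurableType d) (R : realType) (P : probability T R).
Variables (Tf : R -> T -> R) (nu : {measure set (measurableTypeR R) -> \bar R}).
Hypothesis nu_levy : is_levy_measure nu.
Hypothesis nu_infinite : nu `]0, +oo[%classic = +oo%E.
Hypothesis Tf_subordinator : is_subordinator P Tf.
Hypothesis Tf_laplace : forall u t : R, 0 <= u -> 0 <= t ->
  ('E_P[fun w => expR (- (u * Tf t w))] =
   (expR (- (t * laplace_exponent nu u)))%:E)%E.

Local Notation S := (inverse_subordinator Tf).

Let Tf_nd : forall w s t, 0 <= s -> s <= t -> Tf s w <= Tf t w.
Proof. by case: Tf_subordinator. Qed.

Let mTf t : 0 <= t -> measurable_fun setT (Tf t).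
Proof. by move=> t0; case: Tf_subordinator => -[+ _ _ _ _] _; exact. Qed.

Lemma measurable_inverse_subordinator t : measurable_fun setT (S t).
Proof.
apply: (measurability _ (RGenInftyO.measurableE R)) => // _ [_ [a ->] <-].
rewrite setTI (_ : _ @^-1` _ = (if 0 < a then
    \bigcap_n [set w | Tf n.+1%:R w <= t] else set0) `|`
  \bigcup_q (if 0 < (ratr q : R) < a then [set w | t < Tf (ratr q) w] else set0)).
  apply: measurableU.
    case: ifPn => // _; apply: bigcapT_measurable => n.
    rewrite -preimage_itvNyc -[X in measurable X]setTI.
    by apply: mTf => //; exact: measurable_itv.
  apply: bigcupT_measurable_rat => q; case: ifPn => // /andP[q0 _].
  rewrite -preimage_itvoy -[X in measurable X]setTI.
  by apply: mTf; [exact: ltW|by []|exact: measurable_itv].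
apply/seteqP; split => w /=; rewrite in_itv/=.
  move=> /(inverse_subordinator_lt Tf_nd)[[-> h]|[q qa tT]].
    by left => n _; exact: h.
  by right; exists q => //; rewrite qa.
move=> h; apply/(inverse_subordinator_lt Tf_nd); case: h => [|[q _]].
  by case: ifPn => // a0 h; left; split => // n; exact: h.
by case: ifPn => // qa tT; right; exists q.
Qed.

(** Every integer [n] with [Tf n <= t] contributes at least [1], so [W] dominates the number of such
    integers. Its mean is a geometric series of ratio [exp (- f(1)) < 1], where [f] is the Laplace
    exponent. *)
Let W (t : R) w : \bar R := (\sum_(n <oo) (expR (t - Tf n%:R w))%:E)%E.

Let mW n t : measurable_fun setT (fun w => (expR (t - Tf n%:R w))%:E).
Proof.
apply/measurable_EFinP/measurableT_comp => //; apply: measurable_funB => //.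
exact: mTf.
Qed.

Let W_integral t : (\int[P]_w W t w < +oo)%E.
Proof.
rewrite integral_nneseries//.
set q := expR (- laplace_exponent nu 1).
rewrite (eq_eseriesr (g := fun n => (geometric (expR t) q n)%:E)); last first.
  move=> n _; transitivity (\int[P]_w ((expR t)%:E *
      (expR (- (1 * Tf n%:R w)))%:E))%E.
    by apply: eq_integral => w _; rewrite mul1r expRD.
  have := Tf_laplace ler01 (ler0n R n); rewrite unlock => E.
  rewrite ge0_integralZl//; last first.
    apply/measurable_EFinP/measurableT_comp => //; apply: measurableT_comp => //.
    by apply: measurable_funM => //; exact: mTf.
  by rewrite E -EFinM /= /q -expRM_natl mulrN.
have q1 : `|q| < 1.
  by rewrite ger0_norm ?expR_ge0// expR_lt1 oppr_lt0 laplace_exponent1_gt0.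
rewrite (_ : (\sum_(n <oo) _)%E = ((expR t * (1 - q)^-1)%:E)) ?ltry//.
apply/cvg_lim => //.
under eq_fun do rewrite sumEFin.
apply: cvg_EFin; first exact: nearW.
exact: cvg_geometric_series.
Qed.

Let mWt t : measurable_fun setT (W t).
Proof.
apply: ge0_emeasurable_sum => // n _; exact: mW.
Qed.

Let W_partial t w n : (forall k : nat, (k < n)%N -> Tf k%:R w <= t) ->
  (n%:R%:E <= W t w)%E.
Proof.
move=> h; apply: le_trans (nneseries_lim_ge n _) => //.
rewrite sumEFin lee_fin big_mkord -[X in X%:R <= _](card_ord n) -sum1_card.
rewrite natr_sum; apply: ler_sum => k _.
by rewrite -[X in X <= _]expR0 ler_expR subr_ge0 h.
Qed.

Let S_le_W t w : ((S t w)%:E <= 1 + W t w)%E.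
Proof.
have S0 := inverse_subordinator_ge0 Tf t w.
have := truncn_itv S0; set N := Num.truncn _ => /andP[NS SN].
apply: (@le_trans _ _ (1 + N%:R%:E)%E).
  by rewrite -EFinD lee_fin (le_trans (ltW SN))// -natr1 addrC.
rewrite leeD2l//; apply: W_partial => k kN.
apply: (subordinator_le Tf_nd) => //; apply: lt_le_trans NS.
by rewrite ltr_nat.
Qed.

Lemma inverse_subordinator_mean t : (\int[P]_w (S t w)%:E < +oo)%E.
Proof.
apply: (@le_lt_trans _ _ (\int[P]_w (1 + W t w))%E).
  apply: ge0_le_integral => //.
  - by move=> w _; rewrite lee_fin inverse_subordinator_ge0.
  - by apply/measurable_EFinP; exact: measurable_inverse_subordinator.
  - by apply: emeasurable_funD => //; exact: mWt.
rewrite ge0_integralD//; last by move=> w _; exact: nneseries_ge0.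
rewrite integral_cst// mul1e lte_add_pinfty// (le_lt_trans (probability_le1 _ _))//.
by rewrite ltry.
Qed.

(** Two things could make the clock [0]: a path that never exceeds [t], excluded since [W] is almost
    surely finite, or a path that exceeds [t] immediately, excluded by right continuity at [0].
    Positivity also certifies that the infimum is over a nonempty set, hence monotonicity at earlier
    times. *)
Lemma inverse_subordinator_gt0 t : 0 < t -> {ae P, forall w, 0 < S t w}.
Proof.
move=> t0.
have W0 w : (0 <= W t w)%E by exact: nneseries_ge0.
have Wfin : {ae P, forall w, setT w -> W t w \is a fin_num}.
  apply: integrable_ae => //; apply/integrableP; split; first exact: mWt.
  by under eq_integral do rewrite gee0_abs//; exact: W_integral.
have [[_ Tf0 _ _ cadlag] _] := Tf_subordinator.
apply: filterS2 Wfin Tf0 => w /(_ I) Ww Tw0.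
(* Otherwise [W_partial] would put every integer below the finite [W t w]. *)
have [n ntT] : exists n : nat, t < Tf n%:R w.
  apply: contrapT => /forallNP h.
  have h' (n : nat) : (n%:R%:E <= W t w)%E.
    by apply: W_partial => k _; rewrite leNgt; apply/negP.
  have := h' (Num.truncn (fine (W t w))).+1; apply/negP; rewrite -ltNge.
  by rewrite -[X in (X < _)%E]fineK// lte_fin truncnS_gt.
have ne : [set tau : R | 0 < tau /\ t < Tf tau w] !=set0.
  exists n%:R; split => //; rewrite lt_neqAle ler0n andbT eq_sym.
  by apply: contraTneq ntT => ->; rewrite Tw0 -leNgt ltW.
have [+ _] := cadlag w; move=> /(_ 0 (lexx _)); rewrite Tw0.
move=> /cvgr_lt /(_ t t0) near_t.
have [e /= e0 he] := near_t.
have Te : Tf (e / 2) w < t.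
  by apply: he; rewrite /= ?sub0r ?normrN ?ger0_norm ?divr_ge0 ?ltW//
    ?divr_gt0// ltr_pdivrMr// ltr_pMr// ltr1n.
apply: (@lt_le_trans _ _ (e / 2)); first by rewrite divr_gt0.
apply: lb_le_inf => // tau [tau0 tT]; rewrite leNgt; apply/negP => taue.
have := le_lt_trans (Tf_nd w (ltW tau0) (ltW taue)) Te.
by rewrite ltNge (ltW tT).
Qed.

End inverse_subordinator_law.

(** * Time change *)

Section time_change_transfer.
Context d (T : measurableType d) (R : realType) (P : probability T R).
Variables B S : R -> T -> R.
Hypothesis mB : forall t, 0 <= t -> measurable_fun setT (B t).
Hypothesis cB : forall w, {within `[0, +oo[, continuous (fun t => B t w)}.
Hypothesis mS : forall t, 0 <= t -> measurable_fun setT (S t).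
Hypothesis S_ge0 : forall t w, 0 <= S t w.
Hypothesis BS_independent : independent_processes P B S.

Let G : set (set T) :=
  \bigcup_(t in `[0, +oo[) preimage_set_system setT (B t) measurable.
Let H : set (set T) :=
  \bigcup_(t in `[0, +oo[) preimage_set_system setT (S t) measurable.
Let TG : measurableType _ := g_sigma_algebraType G.
Let TH : measurableType _ := g_sigma_algebraType H.

Local Notation F := (natural_filtration `[0, +oo[ B).

Let Gm : <<s G >> `<=` measurable.
Proof.
apply: (@sigma_process_measurable _ _ _ _ B) => t.
by rewrite /= in_itv/= andbT; exact: mB.
Qed.

Let Hm : <<s H >> `<=` measurable.
Proof.
apply: (@sigma_process_measurable _ _ _ _ S) => t.
by rewrite /= in_itv/= andbT; exact: mS.
Qed.

Let mBG t : 0 <= t -> measurable_fun setT (B t : TG -> R).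
Proof.
move=> t0 _ Y mY; rewrite setTI; apply: sub_sigma_algebra; exists t.
  by rewrite /= in_itv/= t0.
by exists Y => //; rewrite setTI.
Qed.

Lemma measurable_clock t : 0 <= t ->
  measurable_fun setT (fun z : TG * TH => S t z.2).
Proof.
move=> t0; have mSH : measurable_fun setT (S t : TH -> R).
  move=> _ Y mY; rewrite setTI; apply: sub_sigma_algebra; exists t.
    by rewrite /= in_itv/= t0.
  by exists Y => //; rewrite setTI.
exact: (measurableT_comp mSH measurable_snd).
Qed.

Let grid (n : nat) (x : R) : R := (Num.truncn (n.+1%:R * x))%:R / n.+1%:R.

Let grid_ge0 n x : 0 <= grid n x.
Proof. by rewrite divr_ge0. Qed.

Let grid_cvg x : 0 <= x -> grid ^~ x @ \oo --> x.
Proof.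
move=> x0; apply: (@squeeze_cvgr _ _ _ _ (fun n => x - n.+1%:R^-1) (fun=> x)).
- apply: nearW => n; rewrite /grid.
  have nx : 0 <= n.+1%:R * x :> R by rewrite mulr_ge0.
  have /andP[lo hi] := truncn_itv nx.
  apply/andP; split; last by rewrite ler_pdivrMr// [leRHS]mulrC.
  by rewrite ler_pdivlMr// mulrBl mulVf// lerBlDr natr1 [leLHS]mulrC ltW.
- rewrite -[X in _ --> X]subr0; apply: cvgB; first exact: cvg_cst.
  exact: cvg_harmonic.
- exact: cvg_cst.
Qed.

(** Rounding the clock down to multiples of [1 / (n + 1)] glues countably many maps
    [B (k / (n + 1))] along events of the clock; the limit is taken with the continuity of the
    paths. *)
Lemma measurable_time_change t : 0 <= t ->
  measurable_fun setT (fun z : TG * TH => B (S t z.2) z.1).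
Proof.
move=> t0.
apply: (@measurable_fun_cvg _ _ _ _
  (fun n (z : TG * TH) => B (grid n (S t z.2)) z.1)).
- move=> n _ Y mY; rewrite setTI.
  rewrite (_ : _ @^-1` Y = \bigcup_k
    ((fst @^-1` (B (k%:R / n.+1%:R) @^-1` Y)) `&`
    ((fun z : TG * TH => S t z.2) @^-1` [set x | grid n x = k%:R / n.+1%:R]))).
    apply: bigcupT_measurable => k; apply: measurableI.
      rewrite -[X in measurable X]setTI; apply: measurable_fst => //.
      by rewrite -[X in measurable X]setTI; apply: mBG => //; rewrite divr_ge0.
    rewrite (_ : _ @^-1` _ = (fun z : TG * TH => S t z.2) @^-1`
        `[k%:R / n.+1%:R, k.+1%:R / n.+1%:R[).
      by rewrite -[X in measurable X]setTI; apply: (measurable_clock t0).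
    apply/seteqP; split => -[w v] /=; rewrite in_itv/= /grid.
      move=> /(congr1 (fun x => x * n.+1%:R)); rewrite !divfK ?pnatr_eq0//.
      move=> /eqP; rewrite eqr_nat => /eqP <-.
      have /andP[lo hi] : _ <= _ < _ :=
        truncn_itv (mulr_ge0 (ler0n R n.+1) (S_ge0 t v)).
      by rewrite ler_pdivrMr// ltr_pdivlMr// (mulrC (S t v)) lo hi.
    rewrite ler_pdivrMr// ltr_pdivlMr// (mulrC (S t v)) => kS.
    by rewrite (truncn_def kS).
  apply/seteqP; split => -[w v] /=.
    by move=> Yw; exists (Num.truncn (n.+1%:R * S t v)).
  by move=> [k _ [/= Yw gk]]; rewrite gk.
- move=> [w v] _ /=.
  have /subspace_continuousP := @cB w.
  move=> /(_ (S t v)); rewrite /= in_itv/= S_ge0 => /(_ isT) c.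
  (* Paths are continuous only within [[0, +oo[], so the approximations have to stay nonnegative. *)
  apply: (@cvg_comp _ _ _ (grid ^~ (S t v)) (B ^~ w) _ _ _ _ c) => U hU.
  have h : \forall n \near \oo, `[0, +oo[%classic (grid n (S t v)) ->
      U (grid n (S t v)) := grid_cvg (S_ge0 t v) hU.
  suff: \forall n \near \oo, U (grid n (S t v)) by [].
  apply: filterS h => n; apply.
  by rewrite /= in_itv/= andbT; exact: grid_ge0.
Qed.

Section sections.
Variables (I : set R) (m : R * R -> R).
Hypothesis I_ge0 : forall t, I t -> 0 <= t.
Hypothesis mm : measurable_fun setT m.

Let M t w := m (time_change B S t w, S t w).

(** The sets with such a lift [E] form a sigma-algebra. For a generator at time [r], the section at
    [v] constrains [B] at the single time [S r v], which the monotonicity at [v] puts before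
    [S s v]. That condition is kept per [v] because it holds only almost surely. *)
Lemma natural_filtration_section s (A : set T) :
  natural_filtration I M s A ->
  exists E : set (TG * TH), [/\ measurable E, A = [set w | E (w, w)] &
    forall v, (forall r, 0 <= r -> r <= s -> S r v <= S s v) ->
    F (S s v) [set w | E (w, v)]].
Proof.
move: A; apply: (@smallest_sub _ _ _ [set A | exists E : set (TG * TH),
  [/\ measurable E, A = [set w | E (w, w)] &
    forall v, (forall r, 0 <= r -> r <= s -> S r v <= S s v) ->
    F (S s v) [set w | E (w, v)]]]).
- split.
  + exists set0; split => //.
    move=> v _; exact: sigma_algebra0.
  + move=> _ [E [mE -> FE]]; exists (~` E); split.
    * exact: measurableC.
    * by rewrite setTD.
    * move=> v /FE; rewrite /natural_filtration/sigma_process => h.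
      rewrite (_ : [set w | _] = setT `\` [set w | E (w, v)]); last first.
        by rewrite setTD.
      exact: sigma_algebraCD.
  + move=> A_ /choice[E hE]; exists (\bigcup_n E n); split.
    * by apply: bigcupT_measurable => n; have [] := hE n.
    * rewrite (eq_bigcupr (G := fun n => [set w | E n (w, w)])); last first.
        by move=> n _; have [] := hE n.
      by apply/seteqP; split => w [n _ h]; exists n.
    * move=> v hv; rewrite (_ : [set w | _] = \bigcup_n [set w | E n (w, v)]).
        by apply: sigma_algebra_bigcup => n; have [_ _] := hE n; exact.
      by apply/seteqP; split => w [n _ h]; exists n.
- move=> _ [r [/= Ir rs] [Y mY <-]].
  have r0 := I_ge0 Ir.
  exists ((fun z : TG * TH => m (B (S r z.2) z.1, S r z.2)) @^-1` Y); split.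
  + rewrite -[X in measurable X]setTI.
    apply: (measurableT_comp mm) => //; apply: measurable_fun_pair.
      exact: measurable_time_change.
    exact: measurable_clock.
  + by rewrite setTI.
  + move=> v /(_ r r0 rs) Srs.
    apply: (@sigma_process_preimage _ _ _ _ B (S r v)
      [set x | Y (m (x, S r v))]).
      by split => //=; rewrite in_itv/= S_ge0.
    have mmr : measurable_fun setT (fun x : R => m (x, S r v)).
      exact: measurable_fun_pair1.
    by rewrite -[X in measurable X]setTI; exact: mmr.
Qed.

Local Open Scope ereal_scope.

Lemma time_change_transfer s (A : set T) (phi1 phi2 : TG * TH -> \bar R) :
  measurable_fun setT phi1 -> (forall z, 0 <= phi1 z) ->
  measurable_fun setT phi2 -> (forall z, 0 <= phi2 z) ->
  {ae P, forall v, (forall r, 0 <= r -> r <= s -> S r v <= S s v)%R /\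
    forall D, F (S s v) D ->
      \int[P]_(w in D) phi1 (w, v) = \int[P]_(w in D) phi2 (w, v)} ->
  natural_filtration I M s A ->
  \int[P]_(w in A) phi1 (w, w) = \int[P]_(w in A) phi2 (w, w).
Proof.
move=> mphi1 phi10 mphi2 phi20 hae /natural_filtration_section[E [mE -> FE]].
(* With the event inside the integrand, Fubini applies on the whole space and the inner integral
   runs over the section of [E]. *)
pose psi (phi : TG * TH -> \bar R) z := phi z * (\1_E z)%:E.
have mpsi (phi : TG * TH -> \bar R) : measurable_fun setT phi ->
    measurable_fun setT (psi phi).
  move=> mphi; apply: emeasurable_funM => //.
  by apply/measurable_EFinP; exact: measurable_indic.
have psi0 (phi : TG * TH -> \bar R) : (forall z, 0 <= phi z) ->
    forall z, 0 <= psi phi z.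
  by move=> phi0 z; rewrite mule_ge0// lee_fin.
have psiE (phi : TG * TH -> \bar R) v : \int[P]_w psi phi (w, v) =
    \int[P]_(w in [set w | E (w, v)]) phi (w, v).
  rewrite [RHS]integral_mkcond epatch_indic; exact: eq_integral.
have diagE (phi : TG * TH -> \bar R) : measurable_fun setT phi ->
    (forall z, 0 <= phi z) ->
    \int[P]_(w in [set w | E (w, w)]) phi (w, w) =
    \int[P]_v \int[P]_w psi phi (w, v).
  move=> mphi phi0.
  rewrite -(independent_sigma_fubini Gm Hm BS_independent (mpsi _ mphi)
    (psi0 _ phi0)).
  rewrite integral_mkcond epatch_indic; exact: eq_integral.
rewrite !diagE//; apply: ae_eq_integral => //.
- exact: (measurable_section_integral P Gm Hm (mpsi _ mphi1) (psi0 _ phi10)).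
- exact: (measurable_section_integral P Gm Hm (mpsi _ mphi2) (psi0 _ phi20)).
apply: filterS hae => v [mono h] _.
by rewrite !psiE; apply: h; exact: FE.
Qed.

End sections.

Lemma time_change_fubini (phi : TG * TH -> \bar R) :
  measurable_fun setT phi -> (forall z, 0 <= phi z)%E ->
  (\int[P]_w phi (w, w) = \int[P]_v \int[P]_w phi (w, v))%E.
Proof. exact: (independent_sigma_fubini Gm Hm BS_independent). Qed.

Lemma measurable_time_change_diag t : 0 <= t ->
  measurable_fun setT (time_change B S t).
Proof.
move=> t0.
have mD : measurable_fun setT (fun w : T => ((w, w) : TG * TH)).
  by apply: measurable_fun_pair; exact: measurable_id_g_sigma_algebra.
exact: (measurableT_comp (measurable_time_change t0) mD).
Qed.

End time_change_transfer.

(** * Martingales *)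

Section natural_martingales.
Context d (T : measurableType d) (R : realType) (P : probability T R).
Local Open Scope ereal_scope.

Lemma natural_martingale (I : set R) (M : R -> T -> R) :
  (forall t, I t -> P.-integrable setT (EFin \o M t)) ->
  (forall s t A, I s -> I t -> (s <= t)%R -> natural_filtration I M s A ->
    \int[P]_(w in A) (M t w)%:E = \int[P]_(w in A) (M s w)%:E) ->
  is_martingale P I M.
Proof.
move=> iM MA; have mM t : I t -> measurable_fun setT (M t).
  by move=> /iM /measurable_int /measurable_EFinP.
have adapted t : I t -> measurable_wrt (natural_filtration I M t) (M t).
  by move=> It Y mY; apply: sigma_process_preimage => //; split => /=.
split => //.
- split=> [t It|s t Is It st].
    split; first exact: smallest_sigma_algebra.
    by apply: sigma_process_measurable => r [Ir _]; exact: mM.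
  apply: sub_sigma_algebra2; apply: bigcup_subset => r [Ir rs].
  by split => //=; exact: le_trans st.
- move=> s t Is It st; split; [exact: adapted|exact: iM|].
  by move=> A FA; rewrite (MA s t).
Qed.

Lemma density_probability (f : T -> R) :
  P.-integrable setT (EFin \o f) -> (forall w, (0 <= f w)%R) ->
  \int[P]_w (f w)%:E = 1 ->
  exists Q : probability T R,
    forall A, measurable A -> Q A = \int[P]_(w in A) (f w)%:E.
Proof.
move=> If f0 f1; pose mu A := \int[P]_(w in A) (f w)%:E.
have mu0 : mu set0 = 0 by exact: integral_set0.
have mu_ge0 A : 0 <= mu A by apply: integral_ge0 => w _; rewrite lee_fin.
have mu_sigma : semi_sigma_additive mu.
  move=> A mA tA mUA; rewrite /mu integral_bigcup//; last first.
    exact: integrableS If.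
  by apply: is_cvg_ereal_nneg_natsum_cond => n _ _; exact: mu_ge0.
pose M : {measure set T -> \bar R} := HB.pack mu
  (isMeasure.Build _ _ _ mu mu0 mu_ge0 mu_sigma).
pose Q : probability T R := HB.pack mu M
  (Measure_isProbability.Build _ _ _ M f1).
by exists Q.
Qed.

End natural_martingales.

Section time_changed_brownian.
Context d (T : measurableType d) (R : realType) (P : probability T R).
Variables (B Tf : R -> T -> R).
Variable nu : {measure set (measurableTypeR R) -> \bar R}.
Hypothesis nu_levy : is_levy_measure nu.
Hypothesis nu_infinite : nu `]0, +oo[%classic = +oo%E.
Hypothesis Tf_subordinator : is_subordinator P Tf.
Hypothesis Tf_laplace : forall u t : R, 0 <= u -> 0 <= t ->
  ('E_P[fun w => expR (- (u * Tf t w))] =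
   (expR (- (t * laplace_exponent nu u)))%:E)%E.
Hypothesis B_brownian : is_brownian_motion P B.
Hypothesis BS_independent : independent_processes P B (inverse_subordinator Tf).

Local Notation S := (inverse_subordinator Tf).
Local Notation X := (time_change B S).

Let TG : measurableType _ := g_sigma_algebraType
  (\bigcup_(t in `[0, +oo[) preimage_set_system setT (B t) measurable).
Let TH : measurableType _ := g_sigma_algebraType
  (\bigcup_(t in `[0, +oo[) preimage_set_system setT (S t) measurable).

Let mB t : 0 <= t -> measurable_fun setT (B t).
Proof. exact: (brownian_process B_brownian). Qed.

Let cB w : {within `[0, +oo[, continuous (fun t => B t w)}.
Proof. by case: B_brownian. Qed.

Let S_ge0 t w : 0 <= S t w.
Proof. exact: inverse_subordinator_ge0. Qed.

Let mS t : 0 <= t -> measurable_fun setT (S t).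
Proof. by move=> _; exact: (measurable_inverse_subordinator Tf_subordinator). Qed.

Let mBS t : 0 <= t -> measurable_fun setT (fun z : TG * TH => B (S t z.2) z.1).
Proof. exact: (measurable_time_change cB S_ge0). Qed.

Let mSt t : 0 <= t -> measurable_fun setT (fun z : TG * TH => S t z.2).
Proof. exact: measurable_clock. Qed.

Let mX t : 0 <= t -> measurable_fun setT (X t).
Proof. exact: (measurable_time_change_diag mB cB mS S_ge0). Qed.

Let fubini (phi : TG * TH -> \bar R) :
  measurable_fun setT phi -> (forall z, 0 <= phi z)%E ->
  (\int[P]_w phi (w, w) = \int[P]_v \int[P]_w phi (w, v))%E.
Proof. exact: (time_change_fubini mB mS BS_independent). Qed.

Lemma inverse_subordinator_nd_ae u : 0 <= u ->
  {ae P, forall v s t, 0 <= s -> s <= t -> t <= u -> S s v <= S t v}.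
Proof.
(* Positivity of the clock is known at positive times, and [u] may be [0]; a later time serves
   equally well. *)
move=> u0; have u1 : 0 < u + 1 by rewrite ltr_wpDl.
have := inverse_subordinator_gt0 nu_levy nu_infinite Tf_subordinator Tf_laplace u1.
apply: filterS => v Sv s t s0 st tu; apply: inverse_subordinator_nd Sv => //.
by rewrite (le_trans tu)// lerDl.
Qed.

Local Open Scope ereal_scope.
Local Notation F := (natural_filtration `[0%R, +oo[ B).

(** The third time [u] is the horizon, which enters the tilted integrands; the two other martingales
    take [u = t]. *)
Lemma time_changed_integral_eq (I : set R) (m : R * R -> R) (s t u : R) (A : set T)
    (phi1 phi2 : TG * TH -> \bar R) :
  (forall r, I r -> 0 <= r)%R -> measurable_fun setT m ->
  (0 <= s)%R -> (s <= t)%R -> (t <= u)%R ->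
  measurable_fun setT phi1 -> (forall z, 0 <= phi1 z) ->
  measurable_fun setT phi2 -> (forall z, 0 <= phi2 z) ->
  (forall v D, (S s v <= S t v)%R -> (S t v <= S u v)%R -> F (S s v) D ->
      \int[P]_(w in D) phi1 (w, v) = \int[P]_(w in D) phi2 (w, v)) ->
  natural_filtration I (fun t w => m (X t w, S t w)) s A ->
  \int[P]_(w in A) phi1 (w, w) = \int[P]_(w in A) phi2 (w, w).
Proof.
move=> I0 mm s0 st tu mphi1 phi10 mphi2 phi20 h.
have t0 : (0 <= t)%R by exact: le_trans st.
have u0 : (0 <= u)%R by exact: le_trans tu.
apply: (time_change_transfer mB cB mS S_ge0 BS_independent I0 mm) => //.
apply: filterS (inverse_subordinator_nd_ae u0) => v nd; split.
  by move=> r r0 rs; apply: nd => //; exact: le_trans tu.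
by move=> D FD; apply: h => //; apply: nd.
Qed.

Lemma time_changed_integrable t : (0 <= t)%R -> P.-integrable setT (EFin \o X t).
Proof.
move=> t0; apply/integrableP; split; first by apply/measurable_EFinP; exact: mX.
rewrite (fubini (phi := fun z => `|B (S t z.2) z.1|%:E)); last 2 first.
- by apply/measurable_EFinP/measurableT_comp => //; exact: mBS.
- by move=> z; rewrite lee_fin.
pose c : R := (2 * expR (1 / 2))%R.
have c0 : (0 <= c)%R by rewrite mulr_ge0 ?expR_ge0.
have mSE : measurable_fun setT (fun v => (S t v)%:E).
  by apply/measurable_EFinP; exact: mS.
apply: (@le_lt_trans _ _ (\int[P]_v (c%:E * (1 + (S t v)%:E)))).
  apply: ge0_le_integral => //.
  - by move=> v _; apply: integral_ge0.
  - apply: (measurable_section_integral P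
      (sigma_process_measurable (X := B) _) (sigma_process_measurable (X := S) _)
      (F := fun z => `|B (S t z.2) z.1|%:E)).
    + by move=> r; rewrite /= in_itv/= andbT; exact: mB.
    + by move=> r; rewrite /= in_itv/= andbT; exact: mS.
    + by apply/measurable_EFinP/measurableT_comp => //; exact: mBS.
    + by move=> z; rewrite lee_fin.
  - by apply: emeasurable_funM => //; exact: emeasurable_funD.
  - move=> v _; rewrite -EFinD -EFinM; exact: brownian_abs_moment.
rewrite ge0_integralZl//; last 2 first.
- exact: emeasurable_funD.
- by move=> v _; rewrite -EFinD lee_fin addr_ge0.
apply: lte_mul_pinfty => //.
rewrite ge0_integralD//; last by move=> v _; rewrite lee_fin.
rewrite integral_cst// mul1e; apply: lte_add_pinfty.
  exact: le_lt_trans (probability_le1 _ _) (ltry _).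
exact: (inverse_subordinator_mean nu_levy nu_infinite Tf_subordinator Tf_laplace).
Qed.

Lemma time_changed_martingale : is_martingale P `[0%R, +oo[ X.
Proof.
have I0 (r : R) : `[0%R, +oo[%classic r -> (0 <= r)%R.
  by rewrite /= in_itv/= andbT.
apply: natural_martingale => [t /I0|s t A /I0 s0 /I0 t0 st FA].
  exact: time_changed_integrable.
have mA : measurable A.
  move: A FA; apply: sigma_process_measurable => r [/I0 r0 _]; exact: mX.
pose p (x : R) := Num.max x 0%R.
have p0 x : (0 <= p x)%R by rewrite le_max lexx orbT.
have mp : measurable_fun setT p by exact: measurable_maxr.
have pE x : p x = (x + p (- x))%R.
  rewrite /p; have [x0|x0] := leP 0%R x.
    by rewrite max_r ?oppr_le0// addr0.
  by rewrite max_l ?oppr_ge0 ?ltW// subrr.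
pose phi a b (z : TG * TH) : \bar R :=
  (p (B (S a z.2) z.1) + p (- B (S b z.2) z.1))%:E.
have mphi a b : (0 <= a)%R -> (0 <= b)%R -> measurable_fun setT (phi a b).
  move=> a0 b0; apply/measurable_EFinP/measurable_funD.
    by apply: measurableT_comp => //; exact: mBS.
  by do 2 apply: measurableT_comp => //; exact: mBS.
have phi0 a b z : 0 <= phi a b z by rewrite lee_fin addr_ge0.
have e : \int[P]_(w in A) (p (X t w) + p (- X s w))%:E =
    \int[P]_(w in A) (p (X s w) + p (- X t w))%:E.
  apply: (time_changed_integral_eq (m := fst) I0 measurable_fst s0 st (lexx t)
    (mphi t s t0 s0) (phi0 t s) (mphi s t s0 t0) (phi0 s t) _ FA).
  move=> v D Sst _ FD;
    exact: (brownian_posneg_martingale B_brownian (S_ge0 s v) Sst FD).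
have iX r : (0 <= r)%R -> P.-integrable A (EFin \o X r).
  by move=> r0; apply: integrableS (time_changed_integrable r0).
(* Adding this integrable function to [X t] and to [X s] gives the two nonnegative integrands of
   [e]; it is subtracted again by [addeK]. *)
have iq : P.-integrable A (fun w => (p (- X s w) + p (- X t w))%:E).
  apply: (@le_integrable _ _ _ _ _ _ _
    (fun w => (`|X s w| + `|X t w|)%:E)) => //.
  - apply/measurable_EFinP/measurable_funD; apply/measurable_funTS.
      by do 2 apply: measurableT_comp => //; exact: mX.
    by do 2 apply: measurableT_comp => //; exact: mX.
  - move=> w _; rewrite /= lee_fin [leLHS]ger0_norm ?addr_ge0//.
    rewrite [leRHS]ger0_norm ?addr_ge0// lerD//.
      by rewrite ge_max normr_ge0 andbT -normrN ler_norm.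
    by rewrite ge_max normr_ge0 andbT -normrN ler_norm.
  - under eq_fun do rewrite EFinD.
    by apply: integrableD => //; apply: integrable_norm; exact: iX.
have fq := integrable_fin_num mA iq.
rewrite -[LHS](addeK _ fq) -[RHS](addeK _ fq); congr (_ - _).
rewrite -!integralD//; [|exact: iX|exact: iX].
transitivity (\int[P]_(w in A) (p (X t w) + p (- X s w))%:E).
  by apply: eq_integral => w _; rewrite -EFinD (pE (X t w)); congr EFin; ring.
rewrite e.
by apply: eq_integral => w _; rewrite -EFinD (pE (X s w)); congr EFin; ring.
Qed.

Let msection (phi : TG * TH -> \bar R) :
  measurable_fun setT phi -> (forall z, 0 <= phi z) ->
  measurable_fun setT (fun v : T => \int[P]_w phi (w, v)).
Proof.
apply: measurable_section_integral; apply: sigma_process_measurable => r.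
  by rewrite /= in_itv/= andbT; exact: mB.
by rewrite /= in_itv/= andbT; exact: mS.
Qed.

Lemma time_changed_exp_martingale :
  is_martingale P `[0%R, +oo[ (fun t w => expR (X t w - 1 / 2 * S t w)).
Proof.
have I0 (r : R) : `[0%R, +oo[%classic r -> (0 <= r)%R.
  by rewrite /= in_itv/= andbT.
pose phi t (z : TG * TH) : \bar R :=
  (expR (B (S t z.2) z.1 - 1 / 2 * S t z.2))%:E.
have mphi t : (0 <= t)%R -> measurable_fun setT (phi t).
  move=> t0; apply/measurable_EFinP/measurableT_comp => //.
  apply: measurable_funB; first exact: mBS.
  by apply: measurable_funM => //; exact: mSt.
have phi0 t z : 0 <= phi t z by rewrite lee_fin expR_ge0.
pose m (z : R * R) : R := expR (z.1 - 1 / 2 * z.2).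
have mm : measurable_fun setT m.
  apply/measurableT_comp => //; apply: measurable_funB => //.
  exact: measurable_funM.
apply: natural_martingale => [t /I0 t0|s t A /I0 s0 /I0 t0 st FA].
  apply/integrableP; split.
    apply/measurable_EFinP/measurableT_comp => //; apply: measurable_funB.
      exact: mX.
    by apply: measurable_funM => //; exact: mS.
  under eq_integral do rewrite /= ger0_norm ?expR_ge0//.
  rewrite (fubini (mphi t t0) (phi0 t)).
  rewrite (eq_integral (cst 1)); last first.
    by move=> v _; exact: (brownian_exp_mass B_brownian (S_ge0 t v)).
  rewrite integral_cst// mul1e.
  exact: le_lt_trans (probability_le1 _ _) (ltry _).
apply: (time_changed_integral_eq (m := m) I0 mm s0 st (lexx t)
  (mphi t t0) (phi0 t) (mphi s s0) (phi0 s) _ FA).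
by move=> v D Sst _ FD;
  exact: (brownian_exp_martingale B_brownian (S_ge0 s v) Sst FD).
Qed.

(** * The exponential of [X] under the tilted measure *)

Section tilted.
Variables h eps : R.
Hypotheses (h0 : (0 <= h)%R) (eps0 : (0 <= eps)%R).

Let rho w := expR (- (1 / 2 * X h w) - (eps + 1 / 8) * S h w).

Let mrho : measurable_fun setT rho.
Proof.
apply: measurableT_comp => //; apply: measurable_funB.
  by apply: measurableT_comp => //; apply: measurable_funM => //; exact: mX.
by apply: measurable_funM => //; exact: mS.
Qed.

Let rho_gt0 w : (0 < rho w)%R. Proof. exact: expR_gt0. Qed.

Let phi t (z : TG * TH) : \bar R := (expR (B (S t z.2) z.1) *
  expR (- (1 / 2 * B (S h z.2) z.1) - (eps + 1 / 8) * S h z.2))%:E.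

Let mphi t : (0 <= t)%R -> measurable_fun setT (phi t).
Proof.
move=> t0; apply/measurable_EFinP/measurable_funM.
  by apply: measurableT_comp => //; exact: mBS.
apply: measurableT_comp => //; apply: measurable_funB.
  by apply: measurableT_comp => //; apply: measurable_funM => //; exact: mBS.
by apply: measurable_funM => //; exact: mSt.
Qed.

Let phi0 t z : 0 <= phi t z.
Proof. by rewrite lee_fin mulr_ge0 ?expR_ge0. Qed.

Let exp_eps v : (expR ((1 / 8 - (eps + 1 / 8)) * S h v) <= 1)%R.
Proof.
rewrite -[leRHS]expR0 ler_expR (_ : _ - _ = - eps)%R; last by ring.
by rewrite mulNr oppr_le0 mulr_ge0.
Qed.

Let rho_mass : \int[P]_w (rho w)%:E <= 1.
Proof.
pose psi (z : TG * TH) : \bar R :=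
  (expR (- (1 / 2 * B (S h z.2) z.1) - (eps + 1 / 8) * S h z.2))%:E.
have mpsi : measurable_fun setT psi.
  apply/measurable_EFinP/measurableT_comp => //; apply: measurable_funB.
    by apply: measurableT_comp => //; apply: measurable_funM => //; exact: mBS.
  by apply: measurable_funM => //; exact: mSt.
have psi0 z : 0 <= psi z by rewrite lee_fin expR_ge0.
rewrite (fubini mpsi psi0) -(probability_setT P) -[leRHS]mul1e.
rewrite -(integral_cst P measurableT 1); apply: ge0_le_integral => //.
- by move=> v _; exact: integral_ge0.
- exact: msection.
- move=> v _; have -> : \int[P]_w psi (w, v) =
      (expR ((1 / 8 - (eps + 1 / 8)) * S h v))%:E.
    exact: (brownian_density_mass B_brownian (eps + 1 / 8) (S_ge0 h v)).
  by rewrite lee_fin.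
Qed.

Let rho_mass_gt0 : 0 < \int[P]_w (rho w)%:E.
Proof.
rewrite lt_neqAle integral_ge0 ?andbT; last first.
  by move=> w _; rewrite lee_fin ltW.
apply/eqP => /esym I0.
have : ae_eq P setT (EFin \o rho) (cst 0).
  apply/(ae_eq_integral_abs P measurableT); first exact/measurable_EFinP.
  by rewrite -[RHS]I0; apply: eq_integral => w _; rewrite gee0_abs// lee_fin ltW.
move=> [N [mN N0 sN]].
have : P setT <= P N.
  apply: le_measure; rewrite ?inE// => w _; apply: sN => /(_ I)/eqP.
  by rewrite /= eqe gt_eqF.
by rewrite N0 probability_setT lee_fin ler10.
Qed.

Let exp_rho_mass t : (0 <= t)%R -> (t <= h)%R ->
  \int[P]_w (expR (X t w) * rho w)%:E <= 1.
Proof.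
move=> t0 th.
rewrite (fubini (mphi t0) (phi0 t)) -(probability_setT P) -[leRHS]mul1e.
rewrite -(integral_cst P measurableT 1); apply: ae_ge0_le_integral => //.
- by move=> v _; exact: integral_ge0.
- exact: (msection (mphi t0) (phi0 t)).
(* The mass is computed from [S t v <= S h v], which may fail on a null event; hence an almost
   everywhere comparison. *)
apply: filterS (inverse_subordinator_nd_ae h0) => v nd _.
have -> : \int[P]_w phi t (w, v) =
    (expR ((1 / 8 - (eps + 1 / 8)) * S h v))%:E.
  have Sth : (S t v <= S h v)%R by apply: nd.
  exact: (brownian_tilted_mass B_brownian (eps + 1 / 8) (S_ge0 t v) Sth).
by rewrite lee_fin.
Qed.

Lemma time_changed_tilted_martingale :
  let c := ((fine (\int[P]_w (rho w)%:E)%E)^-1)%R in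
  exists Q : probability T R,
    (forall A, measurable A -> Q A = c%:E * \int[P]_(w in A) (rho w)%:E) /\
    is_martingale Q `[0%R, h] (fun t w => expR (X t w)).
Proof.
move=> c.
have mass_fin : \int[P]_w (rho w)%:E \is a fin_num.
  by rewrite ge0_fin_numE ?ltW// (le_lt_trans rho_mass)// ltry.
have c0 : (0 <= c)%R by rewrite invr_ge0 fine_ge0// ltW.
have cint A : measurable A ->
    \int[P]_(w in A) (c * rho w)%:E = c%:E * \int[P]_(w in A) (rho w)%:E.
  move=> mA; rewrite -ge0_integralZl//.
  - by apply/measurable_funTS/measurable_EFinP.
  - by move=> w _; rewrite lee_fin ltW.
have [Q QE] : exists Q : probability T R,
    forall A, measurable A -> Q A = \int[P]_(w in A) (c * rho w)%:E.
  apply: density_probability => [|w|].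
  - apply/integrableP; split.
      by apply/measurable_EFinP; exact: measurable_funM.
    under eq_integral do rewrite /= ger0_norm ?mulr_ge0 ?(ltW (rho_gt0 _))//.
    by rewrite cint// lte_mul_pinfty// (le_lt_trans rho_mass)// ltry.
  - by rewrite mulr_ge0// ltW.
  (* The mass is finite and positive, so neither [fine] nor the inverse returns a default value and
     [c] does normalise. *)
  - rewrite cint// /c -[X in _ * X](fineK mass_fin) -EFinM mulVf//.
    by rewrite gt_eqF// fine_gt0// rho_mass_gt0 (le_lt_trans rho_mass)// ltry.
exists Q; split; first by move=> A mA; rewrite QE// cint.
have I0 (r : R) : `[0%R, h]%classic r -> (0 <= r)%R /\ (r <= h)%R.
  by rewrite /= in_itv/= => /andP[].
have mZ t : (0 <= t)%R -> measurable_fun setT (fun w => expR (X t w)).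
  by move=> t0; apply: measurableT_comp => //; exact: mX.
have QZ t A : (0 <= t)%R -> measurable A ->
    \int[Q]_(w in A) (expR (X t w))%:E =
    c%:E * \int[P]_(w in A) (expR (X t w) * rho w)%:E.
  move=> t0 mA; rewrite integral_mkcond epatch_indic.
  rewrite (ge0_integral_density (mu := P) (rho := fun w => c * rho w)%R).
  - rewrite -ge0_integralZl//; last 2 first.
    + by apply/measurable_funTS/measurable_EFinP/measurable_funM => //; exact: mZ.
    + by move=> w _; rewrite lee_fin mulr_ge0 ?expR_ge0// ltW.
    rewrite [RHS]integral_mkcond epatch_indic; apply: eq_integral => w _ /=.
    by rewrite -!EFinM; congr EFin; ring.
  - exact: measurable_funM.
  - by move=> w; rewrite mulr_ge0// ltW.
  - exact: QE.
  - apply: emeasurable_funM; apply/measurable_EFinP; first exact: mZ.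
    exact: measurable_indic.
  - by move=> w; rewrite /= mule_ge0// lee_fin.
apply: natural_martingale => [t /I0[t0 th]|s t A /I0[s0 _] /I0[t0 th] st FA].
  apply/integrableP; split; first by apply/measurable_EFinP; exact: mZ.
  under eq_integral do rewrite /= ger0_norm ?expR_ge0//.
  by rewrite QZ// lte_mul_pinfty// (le_lt_trans (exp_rho_mass t0 th))// ltry.
have mA : measurable A.
  by move: A FA; apply: sigma_process_measurable => r [/I0[r0 _] _]; exact: mZ.
(* Both sides become integrals under [P] weighted by the density at the horizon, where the
   independence of [B] and the clock can be used. *)
rewrite (QZ _ _ t0 mA) (QZ _ _ s0 mA); congr (_ * _).
have mm : measurable_fun setT (fun z : R * R => expR z.1).
  exact: measurableT_comp.
apply: (time_changed_integral_eq (m := fun z => expR z.1)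
  (fun r Ir => (I0 r Ir).1) mm s0 st th
  (mphi t0) (phi0 t) (mphi s0) (phi0 s) _ FA).
move=> v D Sst Sth FD.
exact: (brownian_tilted_martingale B_brownian (eps + 1 / 8) (S_ge0 s v) Sst Sth FD).
Qed.

End tilted.

End time_changed_brownian.

Theorem theorem1 (d : measure_display) (Omega : measurableType d) (R : realType)
    (P : probability Omega R) (B Tf : R -> Omega -> R)
    (nu : {measure set (measurableTypeR R) -> \bar R})
    (nu_levy : is_levy_measure nu)
    (nu_infinite : nu `]0, +oo[%classic = +oo%E)
    (Tf_subordinator : is_subordinator P Tf)
    (Tf_laplace : forall u t : R, 0 <= u -> 0 <= t ->
      ('E_P[fun w => expR (- (u * Tf t w))] =
       (expR (- (t * laplace_exponent nu u)))%:E)%E)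
    (B_brownian : is_brownian_motion P B)
    (BS_independent : independent_processes P B (inverse_subordinator Tf)) :
  let S := inverse_subordinator Tf in
  let X := time_change B S in
  let Y := fun t w => expR (X t w - 1 / 2 * S t w) in
  let Z := fun t w => expR (X t w) in
  (is_martingale P `[0, +oo[ X /\ is_martingale P `[0, +oo[ Y) /\
  (forall horizon : R, 0 <= horizon -> forall eps : R, 0 <= eps ->
    let density := fun w =>
      expR (- (1 / 2 * X horizon w) - (eps + 1 / 8) * S horizon w) in
    let c := (fine (\int[P]_w (density w)%:E)%E)^-1 in
    exists P_eps : probability Omega R,
      (forall A, measurable A ->
         P_eps A = (c%:E * \int[P]_(w in A) (density w)%:E)%E) /\
      is_martingale P_eps `[0, horizon] Z).
Proof.
split; first split.
- exact: (time_changed_martingale nu_levy nu_infinite).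
- exact: (time_changed_exp_martingale nu_levy nu_infinite).
move=> horizon h0 eps eps0.
exact: (time_changed_tilted_martingale nu_levy nu_infinite).
Qed.
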